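(* Let $\alpha\ge0$, let $\beta>0$, and let $f$ be an $\alpha$-harmonic function in $\mathbb{D}$ with boundary function $f^*\in C(\mathbb{T})$, such that $\sup_{z\in\overline{\mathbb{D}}}|f(z)|\le M$, where $M$ is a constant, and such that $f(0)=0$ and $|J_f(0)|=\beta$. Write $$f(z)=\sum_{k=0}^\infty c_kz^k+\sum_{k=1}^\infty c_{-k}P_{\alpha,k}(|z|^2)\overline{z}^{k}\qquad(z\in\mathbb{D}),$$ and suppose that $$c_{-1}=0,\qquad c_{-2}=1,\qquad |c_{-k}|\le k-1\ \text{ for all } k\ge3.$$ Then the following hold, where $c_\alpha=\dfrac{(\Gamma(\frac{\alpha}{2}+1))^2}{\Gamma(\alpha+1)}$ and $\mathbb{D}_r=\{z:|z|<r\}$. (1) $f$ is univalent in $\mathbb{D}_{\rho_0}$, where $\rho_0\in(0,1)$ satisfies the equation $$\frac{\beta c_\alpha}{M(\alpha+2)}-(M+5)\frac{\rho_0(2-\rho_0)}{(1-\rho_0)^2}=0.$$ (2) $f(\mathbb{D}_{\rho_0})$ contains a univalent disk $\mathbb{D}_{R_0}$ with $$R_0\ge(M+5)\left(\frac{\rho_0}{1-\rho_0}\right)^2.$$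
   Context: $\mathbb{D}=\{z\in\mathbb{C}:|z|<1\}$ and $\mathbb{T}=\partial\mathbb{D}$. $\Gamma(s)=\int_0^\infty t^{s-1}e^{-t}\,dt$ $(s>0)$ is the Gamma function. Univalent means injective. A univalent disk contained in $f(\mathbb{D}_{\rho_0})$ is a disk that is the bijective image under $f$ of a subdomain of $\mathbb{D}_{\rho_0}$. Put $\frac{\partial}{\partial z}=\frac12\left(\frac{\partial}{\partial x}-i\frac{\partial}{\partial y}\right)$ and $\frac{\partial}{\partial\overline z}=\frac12\left(\frac{\partial}{\partial x}+i\frac{\partial}{\partial y}\right)$. For $\alpha>-1$, a complex-valued function $f$ is $\alpha$-harmonic in $\mathbb{D}$ if it is twice continuously differentiable in $\mathbb{D}$ and satisfies $\frac{\partial}{\partial z}\left((1-|z|^2)^{-\alpha}\frac{\partial f}{\partial\overline z}\right)=0$ in $\mathbb{D}$. Standing assumption: every $\alpha$-harmonic function $f$ considered has a boundary function $f^*$, in the sense that $f_r\to f^*$ in $\mathcal{D}'(\mathbb{T})$ as $r\to1^-$, where $f_r(e^{i\theta})=f(re^{i\theta})$, and is represented in $\mathbb{D}$ by $$f(z)=\frac1{2\pi}\int_0^{2\pi}\mathcal{P}_\alpha(ze^{-i\theta})f^*(e^{i\theta})\,d\theta,\qquad \mathcal{P}_\alpha(z)=\frac{(1-|z|^2)^{\alpha+1}}{(1-z)(1-\overline z)^{\alpha+1}}.$$ On $\mathbb{T}$ the values of $f$ are those of $f^*$. For $k\ge1$ and $-1<x<1$, $P_{\alpha,k}(x)=\int_0^1t^{k-1}(1-tx)^\alpha\,dt$.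 By a known result of Olofsson and Wittsten, a function in $\mathbb{D}$ is $\alpha$-harmonic if and only if it has a convergent expansion of the form displayed in the claim, where $\{c_k\}_{k=-\infty}^\infty$ is a sequence of complex numbers with $\limsup_{|k|\to\infty}|c_k|^{1/|k|}\le1$. $J_f(z)$ is the Jacobian determinant of $f$ at $z$ (as a map of real variables), so $|J_f(z)|=\big||f_z(z)|^2-|f_{\overline z}(z)|^2\big|$. *)

(* Defs.v *)
From Stdlib Require Export Reals ZArith.
From Coquelicot Require Export Coquelicot.

Open Scope R_scope.

Definition disk (r : R) (z : C) : Prop := Cmod z < r.
Definition circle (z : C) : Prop := Cmod z = 1.

Definition cis (t : R) : C := (cos t, sin t).

Definition CInt (g : R -> C) (a b : R) : C :=
  RInt (V := C_R_CompleteNormedModule) g a b.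

(* Complex-valued partial derivatives with respect to x = Re z and y = Im z.
   [Derive] is total; every use below is at points where [C1_on] or [C2_on]
   guarantees that the derivatives exist. *)
Definition Dx (f : C -> C) (z : C) : C :=
  (Derive (fun t => Re (f (t, Im z))) (Re z),
   Derive (fun t => Im (f (t, Im z))) (Re z)).

Definition Dy (f : C -> C) (z : C) : C :=
  (Derive (fun t => Re (f (Re z, t))) (Im z),
   Derive (fun t => Im (f (Re z, t))) (Im z)).

Definition ex_Dx (f : C -> C) (z : C) : Prop :=
  ex_derive (fun t => Re (f (t, Im z))) (Re z) /\
  ex_derive (fun t => Im (f (t, Im z))) (Re z).

Definition ex_Dy (f : C -> C) (z : C) : Prop :=
  ex_derive (fun t => Re (f (Re z, t))) (Im z) /\
  ex_derive (fun t => Im (f (Re z, t))) (Im z).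

(* Meant for open sets [U]. *)
Definition C1_on (U : C -> Prop) (f : C -> C) : Prop :=
  forall z : C, U z ->
    ex_Dx f z /\ ex_Dy f z /\ continuous (Dx f) z /\ continuous (Dy f) z.

Definition C2_on (U : C -> Prop) (f : C -> C) : Prop :=
  C1_on U f /\ C1_on U (Dx f) /\ C1_on U (Dy f).

Definition d_z (f : C -> C) (z : C) : C :=
  (/ 2 * (Dx f z - Ci * Dy f z))%C.

Definition d_zbar (f : C -> C) (z : C) : C :=
  (/ 2 * (Dx f z + Ci * Dy f z))%C.

Definition Jacobian (f : C -> C) (z : C) : R :=
  Re (Dx f z) * Im (Dy f z) - Re (Dy f z) * Im (Dx f z).

Definition alpha_harmonic (alpha : R) (f : C -> C) : Prop :=
  C2_on (disk 1) f /\
  forall z : C, disk 1 z ->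
    d_z (fun w => (RtoC (Rpower (1 - Cmod w ^ 2) (- alpha)) * d_zbar f w)%C) z
    = RtoC 0.

(* Principal branch of [w ^ a] for [Re w > 0], where the principal argument is
   [atan (Im w / Re w)].  It is only applied to [1 - conj z] with [|z| < 1]. *)
Definition Cpower (w : C) (a : R) : C :=
  (RtoC (Rpower (Cmod w) a) * cis (a * atan (Im w / Re w)))%C.

Definition P_kernel (alpha : R) (z : C) : C :=
  (RtoC (Rpower (1 - Cmod z ^ 2) (alpha + 1))
   / ((1 - z) * Cpower (1 - Cconj z) (alpha + 1)))%C.

(* Continuity of the restriction of [g] to the unit circle. *)
Definition continuous_on_circle (g : C -> C) : Prop :=
  forall z : C, circle z ->
    filterlim g (within circle (locally z)) (locally (g z)).

(* Test functions on the unit circle: smooth 2 pi-periodic functions of the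
   angle. *)
Definition test_function (phi : R -> C) : Prop :=
  (forall t : R, phi (t + 2 * PI) = phi t) /\
  (forall (n : nat) (t : R), ex_derive_n (fun s => Re (phi s)) n t) /\
  (forall (n : nat) (t : R), ex_derive_n (fun s => Im (phi s)) n t).

(* [f_r -> g] as distributions on the unit circle when [r -> 1-], for a
   (continuous) function [g]. *)
Definition distr_boundary_limit (f g : C -> C) : Prop :=
  forall phi : R -> C, test_function phi ->
    filterlim
      (fun r => CInt (fun t => (f (RtoC r * cis t) * phi t)%C) 0 (2 * PI))
      (at_left 1)
      (locally (CInt (fun t => (g (cis t) * phi t)%C) 0 (2 * PI))).

Definition poisson_represented (alpha : R) (f g : C -> C) : Prop :=
  forall z : C, disk 1 z ->
    f z = (RtoC (/ (2 * PI)) *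
           CInt (fun t => P_kernel alpha (z * cis (- t)) * g (cis t))
                0 (2 * PI))%C.

(* Only the values of [fstar] on the unit circle matter. *)
Definition has_boundary_function (alpha : R) (f fstar : C -> C) : Prop :=
  distr_boundary_limit f fstar /\ poisson_represented alpha f fstar.

Definition P_coef (alpha : R) (k : nat) (x : R) : R :=
  RInt (fun t => t ^ (k - 1) * Rpower (1 - t * x) alpha) 0 1.

(* [x ^ (1 / n)] for [x >= 0] and [n >= 1]; the case distinction is needed
   because [Rpower 0 y = 1]. *)
Definition nth_root (n : nat) (x : R) : R :=
  if Rlt_dec 0 x then Rpower x (/ INR n) else 0.

(* limsup of [|c_k| ^ (1 / |k|)] as [|k| -> oo]: for each [n = |k|] both signs
   of [k] are taken into account. *)
Definition limsup_root (c : Z -> C) : Rbar :=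
  LimSup_seq (fun n =>
    Rmax (nth_root n (Cmod (c (Z.of_nat n))))
         (nth_root n (Cmod (c (- Z.of_nat n)%Z)))).

Definition alpha_expansion (alpha : R) (c : Z -> C) (f : C -> C) : Prop :=
  Rbar_le (limsup_root c) 1 /\
  forall z : C, disk 1 z ->
    exists S1 S2 : C,
      is_series (V := C_NormedModule)
        (fun k : nat => (c (Z.of_nat k) * z ^ k)%C) S1 /\
      is_series (V := C_NormedModule)
        (fun j : nat => let k := S j in
           (c (- Z.of_nat k)%Z * RtoC (P_coef alpha k (Cmod z ^ 2))
            * Cconj z ^ k)%C) S2 /\
      f z = (S1 + S2)%C.

Definition Gamma (s : R) : R :=
  RInt_gen (fun t => Rpower t (s - 1) * exp (- t))
           (at_right 0) (Rbar_locally p_infty).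

Definition c_const (alpha : R) : R :=
  Gamma (alpha / 2 + 1) ^ 2 / Gamma (alpha + 1).

Definition univalent_on (U : C -> Prop) (f : C -> C) : Prop :=
  forall z w : C, U z -> U w -> f z = f w -> z = w.

Definition connected_set (U : C -> Prop) : Prop :=
  forall A B : C -> Prop, open A -> open B ->
    (forall z, U z -> A z \/ B z) ->
    (exists z, U z /\ A z) -> (exists z, U z /\ B z) ->
    exists z, U z /\ A z /\ B z.

Definition domain (U : C -> Prop) : Prop :=
  open U /\ connected_set U /\ exists z, U z.

(* The disk [disk R0] is the bijective image under [f] of a subdomain of
   [disk rho]; in particular it is contained in the image of [disk rho]. *)
Definition univalent_disk_in_image (f : C -> C) (rho R0 : R) : Prop :=
  exists U : C -> Prop,
    domain U /\
    (forall z, U z -> disk rho z) /\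
    univalent_on U f /\
    (forall w : C, disk R0 w <-> exists z, U z /\ f z = w).

(* Main.v *)
Require Import Defs.
From Stdlib Require Import Lra Lia Psatz IndefiniteDescription.

(** Write [f z = c_1 z + h z], where [h] collects the terms of index [|k| >= 2].
    Integrating [f (r e^(it)) e^(-ikt)] over the circle gives [|c_k| <= M], and
    since [h z = O(|z|^2)] the Jacobian at 0 is [|c_1|^2 = beta].  As
    [c_alpha <= 1], the equation for [rho] then says
    [|c_1| >= (M + 5) rho (2 - rho) / (1 - rho)^2].

    The functions [P_k(x)] and [x^k P_k(x)] are respectively decreasing and
    increasing in [x], which makes [P_k(|z|^2) conj(z)^k] Lipschitz with constant
    [3 rho^(k-1)] on [|z| <= rho].  Summing, [h] is Lipschitz there with constant
    [M (1 / (1 - rho)^2 - 1) + 3 rho / (1 - rho)^2 < |c_1|], so [f] is injective.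
    Moreover [|h| <= (M + 1) rho^2 / (1 - rho)], so for [|w| < R0] the map
    [z |-> (w - h z) / c_1] is a contraction of the closed disk, and its fixed
    point solves [f z = w].  The preimage of the disk is connected because the
    inverse of [f] is Lipschitz. *)

(** * The Gamma function *)

Lemma ex_RInt_pos (g : R -> R) (x y : R) :
  (forall t, 0 < t -> continuous g t) -> 0 < x -> 0 < y -> ex_RInt g x y.
Proof.
  intros Hc Hx Hy. apply (ex_RInt_continuous (V := R_CompleteNormedModule)).
  intros z [Hz _]. apply Hc. apply Rlt_le_trans with (2 := Hz). now apply Rmin_glb_lt.
Qed.

(** For a nonnegative integrand the integral over [x, y] grows with the interval, so the improper
    integral is the supremum of these integrals, which is finite because of [B]. *)
Lemma is_RInt_gen_sup (g : R -> R) (B : R) :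
  (forall t, 0 < t -> continuous g t) -> (forall t, 0 < t -> 0 <= g t) ->
  (forall x y, 0 < x <= y -> RInt g x y <= B) ->
  exists l, is_RInt_gen g (at_right 0) (Rbar_locally p_infty) l /\
    is_lub (fun v => exists x y, 0 < x <= y /\ v = RInt g x y) l.
Proof.
  intros Hc H0 HB.
  destruct (completeness (fun v => exists x y, 0 < x <= y /\ v = RInt g x y)) as [l Hl].
  - exists B. intros v (x & y & Hxy & ->). now apply HB.
  - exists (RInt g 1 1), 1, 1. split; [lra | reflexivity].
  - exists l. split; [| exact Hl]. destruct Hl as [Hu Hm].
    intros P [eps HP].
    (* An interval [x0, y0] whose integral is within [eps] of the supremum; every larger interval
       does at least as well. *)
    assert (exists x0 y0, 0 < x0 <= y0 /\ l - eps < RInt g x0 y0) as (x0 & y0 & H1 & H2).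
    { apply Classical_Prop.NNPP. intros Hn. pose proof (cond_pos eps).
      assert (l <= l - eps); [| lra]. apply Hm. intros v (x & y & Hxy & ->).
      apply Rnot_lt_le. intros Hlt. apply Hn. now exists x, y. }
    apply (Filter_prod _ _ _ (fun x => 0 < x < x0) (fun y => y0 < y)).
    + exists (mkposreal x0 (proj1 H1)). intros x Hx Hx0. split; [exact Hx0 |].
      unfold ball in Hx; simpl in Hx; unfold AbsRing_ball, abs, minus, plus, opp in Hx; simpl in Hx.
      apply Rabs_def2 in Hx. lra.
    + exists y0. auto.
    + intros x y Hx Hy. simpl. exists (RInt g x y). split.
      * apply (RInt_correct (V := R_CompleteNormedModule)). apply ex_RInt_pos; auto; lra.
      * apply HP.
        assert (RInt g x y <= l) by (apply Hu; exists x, y; split; [lra | reflexivity]).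
        assert (RInt g x0 y0 <= RInt g x y).
        { rewrite <- (RInt_Chasles g x x0 y), <- (RInt_Chasles g x0 y0 y);
            try (apply ex_RInt_pos; auto; lra).
          assert (0 <= RInt g x x0).
          { apply RInt_ge_0; [lra | apply ex_RInt_pos; auto; lra |]. intros; apply H0; lra. }
          assert (0 <= RInt g y0 y).
          { apply RInt_ge_0; [lra | apply ex_RInt_pos; auto; lra |]. intros; apply H0; lra. }
          unfold plus; simpl; lra. }
        unfold ball; simpl; unfold AbsRing_ball, abs, minus, plus, opp; simpl.
        apply Rabs_def1; lra.
Qed.

Definition Gamma_integrand (a t : R) : R := Rpower t a * exp (- t).

Lemma Gamma_integrand_pos a t : 0 < Gamma_integrand a t.
Proof. apply Rmult_lt_0_compat; apply exp_pos. Qed.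

Lemma continuous_Gamma_integrand a t : 0 < t -> continuous (Gamma_integrand a) t.
Proof.
  intros Ht. apply (ex_derive_continuous (V := R_NormedModule)).
  unfold Gamma_integrand, Rpower. auto_derive. exact Ht.
Qed.

(** Half of the exponential decay absorbs the power: t^a e^(-t) <= K e^(-t/2), and the integral of K
    e^(-t/2) over (0, oo) is 2K. *)
Lemma RInt_Gamma_integrand_le a x y : 0 <= a -> 0 < x <= y ->
  RInt (Gamma_integrand a) x y <= 2 * exp (a * ln (2 * (a + 1))).
Proof.
  intros Ha Hxy. set (K := exp (a * ln (2 * (a + 1)))).
  assert (HK : 0 < K) by apply exp_pos.
  assert (HI : is_RInt (fun t => K * exp (- t / 2)) x y
                 (-2 * K * exp (- y / 2) - -2 * K * exp (- x / 2))).
  { apply (is_RInt_derive (V := R_CompleteNormedModule) (fun t => -2 * K * exp (- t / 2))).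
    - intros t _. auto_derive; [easy |]. unfold Rdiv. lra.
    - intros t _. apply (ex_derive_continuous (V := R_NormedModule)). auto_derive. easy. }
  apply Rle_trans with (-2 * K * exp (- y / 2) - -2 * K * exp (- x / 2)).
  - rewrite <- (is_RInt_unique _ _ _ _ HI). apply RInt_le.
    + lra.
    + apply ex_RInt_pos; try lra. apply continuous_Gamma_integrand.
    + eexists; exact HI.
    + intros t Ht. unfold Gamma_integrand, Rpower, K. rewrite <- !exp_plus.
      (* This is ln s <= s at s = t / (2 (a + 1)); the scale 2 (a + 1) is chosen so that a s <= t /
         2. *)
      assert (Hln : ln t <= t / (2 * (a + 1)) + ln (2 * (a + 1))).
      { replace t with ((t / (2 * (a + 1))) * (2 * (a + 1))) at 1 by (field; lra).
        assert (0 < t / (2 * (a + 1))) by (apply Rdiv_lt_0_compat; lra).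
        rewrite ln_mult by lra. apply Rplus_le_compat_r.
        rewrite <- (ln_exp (t / (2 * (a + 1)))) at 2.
        apply Rcomplements.ln_le; [lra |].
        pose proof (exp_ineq1_le (t / (2 * (a + 1)))); lra. }
      assert (a * (t / (2 * (a + 1))) <= t / 2).
      { replace (t / 2) with ((a + 1) * (t / (2 * (a + 1)))) by (field; lra).
        apply Rmult_le_compat_r; [| lra]. apply Rlt_le, Rdiv_lt_0_compat; lra. }
      apply (Rmult_le_compat_l a) in Hln; [| exact Ha].
      assert (Hexp : a * ln t + - t <= a * ln (2 * (a + 1)) + - t / 2) by lra.
      destruct Hexp as [Hexp | ->]; [left; now apply exp_increasing | right; reflexivity].
  - assert (exp (- x / 2) <= 1).
    { rewrite <- exp_0. left. apply exp_increasing. lra. }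
    pose proof (exp_pos (- y / 2)). nra.
Qed.

(** Estimates for the Gamma function thereby reduce to proper integrals over compact intervals. *)
Lemma Gamma_is_lub a : 0 <= a ->
  is_lub (fun v => exists x y, 0 < x <= y /\ v = RInt (Gamma_integrand a) x y)
    (Gamma (a + 1)).
Proof.
  intros Ha.
  destruct (is_RInt_gen_sup (Gamma_integrand a) (2 * exp (a * ln (2 * (a + 1))))) as (l & Hl & Hlub).
  - intros; now apply continuous_Gamma_integrand.
  - intros; left; apply Gamma_integrand_pos.
  - intros; now apply RInt_Gamma_integrand_le.
  - replace (Gamma (a + 1)) with l; [exact Hlub |].
    symmetry. unfold Gamma. replace (a + 1 - 1) with a by ring.
    now apply (is_RInt_gen_unique (V := R_CompleteNormedModule)).
Qed.

Lemma Gamma_pos a : 0 <= a -> 0 < Gamma (a + 1).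
Proof.
  intros Ha. apply Rlt_le_trans with (RInt (Gamma_integrand a) 1 2).
  - apply RInt_gt_0; [lra | intros; apply Gamma_integrand_pos |].
    intros x Hx. apply continuous_Gamma_integrand. lra.
  - apply (Gamma_is_lub a Ha). exists 1, 2. split; [lra | reflexivity].
Qed.

(* Cauchy-Schwarz, obtained by integrating
   [2 t^(a/2) <= t^a / G + G] for [G = Gamma (a/2 + 1)]. *)
Lemma Gamma_half_sqr_le a : 0 <= a -> Gamma (a / 2 + 1) ^ 2 <= Gamma (a + 1).
Proof.
  intros Ha. assert (Ha2 : 0 <= a / 2) by lra.
  pose proof (Gamma_pos (a / 2) Ha2) as HG. set (G := Gamma (a / 2 + 1)) in *.
  (* Multiplied by 2G, this reads 2 G^2 <= Gamma (a + 1) + G^2. *)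
  enough (G <= (Gamma (a + 1) / G + G) / 2).
  { assert (G * G <= Gamma (a + 1)); [| nra].
    apply Rmult_le_reg_r with (/ G); [now apply Rinv_0_lt_compat |].
    rewrite Rmult_assoc, Rinv_r by lra. unfold Rdiv in *. lra. }
  apply (Gamma_is_lub (a / 2) Ha2). intros v (x & y & Hxy & ->).
  assert (HI : is_RInt (fun t => exp (- t)) x y (- exp (- y) - - exp (- x))).
  { apply (is_RInt_derive (V := R_CompleteNormedModule) (fun t => - exp (- t))).
    - intros t _. auto_derive; [easy |]. ring.
    - intros t _. apply (ex_derive_continuous (V := R_NormedModule)). auto_derive. easy. }
  assert (HJ : is_RInt (Gamma_integrand a) x y (RInt (Gamma_integrand a) x y)).
  { apply (RInt_correct (V := R_CompleteNormedModule)), ex_RInt_pos; try lra.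
    apply continuous_Gamma_integrand. }
  assert (HJle : RInt (Gamma_integrand a) x y <= Gamma (a + 1)).
  { apply (Gamma_is_lub a Ha). now exists x, y. }
  assert (HS : is_RInt (fun t => / (2 * G) * Gamma_integrand a t + G / 2 * exp (- t)) x y
            (/ (2 * G) * RInt (Gamma_integrand a) x y + G / 2 * (- exp (- y) - - exp (- x)))).
  { exact (is_RInt_plus _ _ _ _ _ _ (is_RInt_scal _ _ _ (/ (2 * G)) _ HJ)
             (is_RInt_scal _ _ _ (G / 2) _ HI)). }
  apply Rle_trans with (RInt (fun t => / (2 * G) * Gamma_integrand a t + G / 2 * exp (- t)) x y).
  - apply RInt_le; [lra | | eexists; exact HS |].
    + apply ex_RInt_pos; try lra. apply continuous_Gamma_integrand.
    + intros t Ht. unfold Gamma_integrand.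
      replace (Rpower t a) with (Rpower t (a / 2) * Rpower t (a / 2))
        by (rewrite <- Rpower_plus; f_equal; lra).
      set (p := Rpower t (a / 2)). pose proof (exp_pos (- t)) as He.
      assert (0 <= (p - G) ^ 2 * (/ (2 * G))).
      { apply Rmult_le_pos; [apply pow2_ge_0 |]. left; apply Rinv_0_lt_compat; lra. }
      (* Completing the square shows that the integrand exceeds p e^(-t) by a nonnegative term. *)
      replace (/ (2 * G) * (p * p * exp (- t)) + G / 2 * exp (- t))
        with ((p + (p - G) ^ 2 * / (2 * G)) * exp (- t)) by (field; lra).
      apply Rmult_le_compat_r; lra.
  - rewrite (is_RInt_unique _ _ _ _ HS).
    assert (exp (- x) <= 1) by (rewrite <- exp_0; left; apply exp_increasing; lra).
    pose proof (exp_pos (- y)).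
    replace ((Gamma (a + 1) / G + G) / 2) with (/ (2 * G) * Gamma (a + 1) + G / 2 * 1) by (field; lra).
    apply Rplus_le_compat; apply Rmult_le_compat_l; try lra.
    left; apply Rinv_0_lt_compat; lra.
Qed.

Lemma c_const_bounds a : 0 <= a -> 0 < c_const a <= 1.
Proof.
  intros Ha. pose proof (Gamma_pos a Ha) as H1. assert (Ha2 : 0 <= a / 2) by lra.
  pose proof (Gamma_pos (a / 2) Ha2) as H2. pose proof (Gamma_half_sqr_le a Ha) as H3.
  unfold c_const. split.
  - apply Rdiv_lt_0_compat; [nra | lra].
  - apply Rmult_le_reg_r with (Gamma (a + 1)); [lra |].
    unfold Rdiv. rewrite Rmult_assoc, Rinv_l by lra. lra.
Qed.

(** * The functions [P_k] *)

(** The condition x b < 1 keeps 1 - t x positive on [0, b], also for negative x. The endpoint [b] is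
    free because the rescaled integral of [P_coef_scaled] runs over [0, x]. *)
Lemma ex_RInt_P_coef a k x b : x * b < 1 -> 0 <= b ->
  ex_RInt (fun t => t ^ (k - 1) * Rpower (1 - t * x) a) 0 b.
Proof.
  intros Hx Hb. apply (ex_RInt_continuous (V := R_CompleteNormedModule)).
  rewrite Rmin_left, Rmax_right by assumption.
  intros t Ht. apply (ex_derive_continuous (V := R_NormedModule)).
  unfold Rpower. auto_derive. repeat split. destruct (Rle_dec 0 x); nra.
Qed.

Lemma Rpower_le_1 a y : 0 <= a -> 0 < y <= 1 -> Rpower y a <= 1.
Proof.
  intros Ha Hy. rewrite <- (Rpower_O y) by lra.
  destruct (Req_dec y 1) as [-> | Hne].
  - unfold Rpower. rewrite ln_1, !Rmult_0_r. lra.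
  - unfold Rpower. assert (ln y < 0) by (rewrite <- ln_1; apply ln_increasing; lra).
    assert (a * ln y <= 0 * ln y) by nra.
    destruct H0 as [H0 | ->]; [left; now apply exp_increasing | right; reflexivity].
Qed.

Lemma is_RInt_pow k : is_RInt (fun t => t ^ k) 0 1 (/ INR (S k)).
Proof.
  assert (INR (S k) <> 0) by (apply not_0_INR; lia).
  replace (/ INR (S k)) with (minus (1 ^ S k / INR (S k)) (0 ^ S k / INR (S k))).
  - apply (is_RInt_derive (V := R_CompleteNormedModule) (fun t => t ^ S k / INR (S k))).
    + intros t _. auto_derive; [easy |]. simpl Nat.pred. field. exact H.
    + intros t _. apply (ex_derive_continuous (V := R_NormedModule)). auto_derive. easy.
  - rewrite pow1. unfold minus, plus, opp; simpl. field. exact H.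
Qed.

(** Since a >= 0, the factor (1 - t x)^a is at most 1, which leaves the integral of t^(k-1). *)
Lemma P_coef_bounds a k x : 0 <= a -> (1 <= k)%nat -> 0 <= x < 1 ->
  0 <= P_coef a k x <= / INR k.
Proof.
  intros Ha Hk Hx. unfold P_coef. split.
  - apply RInt_ge_0; [lra | apply ex_RInt_P_coef; lra |].
    intros t Ht. apply Rmult_le_pos; [apply pow_le; lra | left; apply exp_pos].
  - destruct k as [| k]; [lia |]. replace (S k - 1)%nat with k by lia.
    rewrite <- (is_RInt_unique _ _ _ _ (is_RInt_pow k)).
    apply RInt_le; [lra | | eexists; apply is_RInt_pow |].
    + pose proof (ex_RInt_P_coef a (S k) x 1) as H. replace (S k - 1)%nat with k in H by lia.
      apply H; lra.
    + intros t Ht. rewrite <- (Rmult_1_r (t ^ k)) at 2. apply Rmult_le_compat_l.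
      * apply pow_le; lra.
      * apply Rpower_le_1; [exact Ha | nra].
Qed.

Lemma P_coef_decr a k x y : 0 <= a -> 0 <= x <= y -> y < 1 ->
  P_coef a k y <= P_coef a k x.
Proof.
  intros Ha Hx Hy. unfold P_coef.
  apply RInt_le; [lra | apply ex_RInt_P_coef; lra | apply ex_RInt_P_coef; lra |].
  intros t Ht. apply Rmult_le_compat_l; [apply pow_le; lra |].
  apply Rle_Rpower_l; [exact Ha | nra].
Qed.

(* The substitution [s = t x] turns [x^k P_k(x)] into an integral over [0, x]
   whose integrand does not depend on [x]. *)
Lemma P_coef_scaled a k x : (1 <= k)%nat -> 0 <= x < 1 ->
  x ^ k * P_coef a k x = RInt (fun s => s ^ (k - 1) * Rpower (1 - s * 1) a) 0 x.
Proof.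
  intros Hk Hx. unfold P_coef.
  rewrite <- (RInt_scal (V := R_CompleteNormedModule)) by (apply ex_RInt_P_coef; lra).
  pose proof (RInt_comp_lin (V := R_CompleteNormedModule)
                (fun s => s ^ (k - 1) * Rpower (1 - s * 1) a) x 0 0 1) as H.
  rewrite Rmult_0_r, Rmult_1_r, !Rplus_0_r in H.
  rewrite <- H by (apply ex_RInt_P_coef; lra).
  apply RInt_ext. intros t _. unfold scal; simpl; unfold mult; simpl.
  rewrite Rplus_0_r, Rpow_mult_distr, Rmult_1_r, (Rmult_comm x t).
  replace (x ^ k) with (x * x ^ (k - 1)) by (rewrite tech_pow_Rmult; f_equal; lia).
  ring.
Qed.

Lemma P_coef_scaled_incr a k x y : 0 <= a -> (1 <= k)%nat -> 0 <= x <= y -> y < 1 ->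
  x ^ k * P_coef a k x <= y ^ k * P_coef a k y.
Proof.
  intros Ha Hk Hx Hy. rewrite !P_coef_scaled by (assumption || lra).
  assert (E : forall u v, 0 <= u <= v -> v < 1 ->
            ex_RInt (fun s => s ^ (k - 1) * Rpower (1 - s * 1) a) u v).
  { intros u v Hu Hv. apply (ex_RInt_Chasles_2 (V := R_CompleteNormedModule)) with 0; [exact Hu |].
    apply ex_RInt_P_coef; lra. }
  rewrite <- (RInt_Chasles (V := R_CompleteNormedModule) _ 0 x y) by (apply E; lra).
  assert (0 <= RInt (fun s => s ^ (k - 1) * Rpower (1 - s * 1) a) x y).
  { apply RInt_ge_0; [lra | apply E; lra |].
    intros t Ht. apply Rmult_le_pos; [apply pow_le; lra | left; apply exp_pos]. }
  unfold plus; simpl. lra.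
Qed.

(** A form of Bernoulli's inequality. *)
Lemma one_sub_pow_le q k : 0 <= q <= 1 -> 1 - q ^ k <= INR k * (1 - q).
Proof.
  intros Hq. induction k as [| k IH]; [simpl; lra |].
  rewrite S_INR. simpl. pose proof (pow_le q k (proj1 Hq)).
  assert (q ^ k <= 1) by (rewrite <- (pow1 k); apply pow_incr; lra). nra.
Qed.

(** The two monotonicities pinch the difference. With q = x / y they give q^k P_k(x) <= P_k(y), so
    the difference is at most (1 - q^k) P_k(x) <= k (1 - q) / k = 1 - q, a bound free of k and of
    the exponent. *)
Lemma P_coef_variation a k x y : 0 <= a -> (1 <= k)%nat -> 0 <= x <= y -> 0 < y < 1 ->
  0 <= P_coef a k x - P_coef a k y <= (y - x) / y.
Proof.
  intros Ha Hk Hx Hy.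
  pose proof (P_coef_decr a k x y Ha Hx (proj2 Hy)).
  pose proof (P_coef_scaled_incr a k x y Ha Hk Hx (proj2 Hy)) as Hs.
  destruct (P_coef_bounds a k x Ha Hk ltac:(lra)) as [HP0 HP1].
  split; [lra |]. set (q := x / y).
  assert (Hq : 0 <= q <= 1).
  { unfold q. split; [apply Rdiv_le_0_compat; lra |].
    apply Rmult_le_reg_r with y; [lra |]. unfold Rdiv. rewrite Rmult_assoc, Rinv_l; lra. }
  assert (Hxq : x = q * y) by (unfold q; field; lra).
  assert (Hqk : q ^ k * P_coef a k x <= P_coef a k y).
  { apply Rmult_le_reg_l with (y ^ k); [apply pow_lt; lra |].
    rewrite Hxq in Hs at 1. rewrite Rpow_mult_distr in Hs. lra. }
  replace ((y - x) / y) with (1 - q) by (unfold q; field; lra).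
  pose proof (one_sub_pow_le q k Hq) as Hb.
  assert (HkP : INR k * P_coef a k x <= 1).
  { assert (0 < INR k) by (apply lt_0_INR; lia).
    apply (Rmult_le_compat_l (INR k)) in HP1; [| lra]. rewrite Rinv_r in HP1; lra. }
  assert ((1 - q ^ k) * P_coef a k x <= INR k * (1 - q) * P_coef a k x)
    by (apply Rmult_le_compat_r; assumption).
  nra.
Qed.

(** * Lipschitz estimates for powers and antiholomorphic terms *)

Lemma Cpow_diff_le (k : nat) (r : R) (z w : C) : Cmod z <= r -> Cmod w <= r ->
  Cmod (z ^ S k - w ^ S k) <= INR (S k) * r ^ k * Cmod (z - w).
Proof.
  intros Hz Hw. assert (0 <= r) by (pose proof (Cmod_ge_0 z); lra).
  induction k as [| k IH].
  - simpl. rewrite !Cmult_1_r. lra.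
  - replace (z ^ S (S k) - w ^ S (S k))%C
      with (z * (z ^ S k - w ^ S k) + (z - w) * w ^ S k)%C by (simpl; ring).
    eapply Rle_trans; [apply Cmod_triangle |].
    rewrite !Cmod_mult, Cmod_pow, (S_INR (S k)), Rmult_plus_distr_r, Rmult_plus_distr_r, Rmult_1_l.
    apply Rplus_le_compat.
    + replace (INR (S k) * r ^ S k * Cmod (z - w)) with (r * (INR (S k) * r ^ k * Cmod (z - w)))
        by (simpl; ring).
      apply Rmult_le_compat; auto using Cmod_ge_0.
    + rewrite Rmult_comm. apply Rmult_le_compat_r; [apply Cmod_ge_0 |].
      apply pow_incr. split; [apply Cmod_ge_0 | exact Hw].
Qed.

Lemma Cmod_diff_le (z w : C) : Cmod z - Cmod w <= Cmod (z - w).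
Proof.
  replace z with (z - w + w)%C at 1 by ring.
  pose proof (Cmod_triangle (z - w) w). lra.
Qed.

Definition antiholo_term (a : R) (k : nat) (z : C) : C :=
  (P_coef a k (Cmod z ^ 2) * Cconj z ^ k)%C.

(** The constant is 3 = 1 + 2. Varying the power costs P_(k+1) (k + 1) r^k <= r^k, and varying the
    factor P_(k+1) costs 2 r^k by [P_coef_variation]. *)
Lemma antiholo_term_lip a k r (z w : C) : 0 <= a -> Cmod z <= r -> Cmod w <= r -> r < 1 ->
  Cmod (antiholo_term a (S k) z - antiholo_term a (S k) w) <= 3 * r ^ k * Cmod (z - w).
Proof.
  intros Ha. revert z w.
  (* By symmetry the point of larger modulus may be taken first, which orders the arguments of P. *)
  enough (H : forall z w, Cmod w <= Cmod z -> Cmod z <= r -> r < 1 ->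
    Cmod (antiholo_term a (S k) z - antiholo_term a (S k) w) <= 3 * r ^ k * Cmod (z - w)).
  { intros z w Hz Hw Hr. destruct (Rle_dec (Cmod w) (Cmod z)) as [Hle | Hle].
    - now apply H.
    - rewrite <- (Cmod_opp (z - w)), <- (Cmod_opp (antiholo_term _ _ _ - _)), !Copp_minus_distr.
      apply H; lra. }
  intros z w Hwz Hz Hr. set (x := Cmod w ^ 2). set (y := Cmod z ^ 2).
  pose proof (Cmod_ge_0 w) as H0.
  assert (Hxy : 0 <= x <= y) by (unfold x, y; nra).
  assert (Hy1 : y < 1) by (unfold y; nra).
  unfold antiholo_term. fold x y.
  replace (P_coef a (S k) y * Cconj z ^ S k - P_coef a (S k) x * Cconj w ^ S k)%C
    with (P_coef a (S k) y * (Cconj z ^ S k - Cconj w ^ S k)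
          - RtoC (P_coef a (S k) x - P_coef a (S k) y) * Cconj w ^ S k)%C
    by (rewrite RtoC_minus; ring).
  eapply Rle_trans; [apply Cmod_triangle |].
  rewrite Cmod_opp, !Cmod_mult, !Cmod_R, Cmod_pow, Cmod_conj.
  replace (3 * r ^ k * Cmod (z - w)) with (r ^ k * Cmod (z - w) + 2 * r ^ k * Cmod (z - w)) by ring.
  destruct (P_coef_bounds a (S k) y Ha ltac:(lia) ltac:(lra)) as [HP0 HP1].
  assert (HI : 0 < INR (S k)) by (apply lt_0_INR; lia).
  apply Rplus_le_compat.
  - rewrite Rabs_pos_eq by exact HP0.
    pose proof (Cpow_diff_le k r (Cconj z) (Cconj w)) as Hd.
    rewrite <- Cminus_conj, !Cmod_conj in Hd. specialize (Hd Hz ltac:(lra)).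
    replace (r ^ k * Cmod (z - w)) with (/ INR (S k) * (INR (S k) * r ^ k * Cmod (z - w))) by (field; lra).
    apply Rmult_le_compat; auto using Cmod_ge_0.
  (* If z = 0 then w = 0 too; otherwise division by |z| is allowed. *)
  - destruct (Req_dec (Cmod z) 0) as [Hz0 | Hz0].
    + replace (Cmod w) with 0 by lra. simpl. rewrite Rmult_0_l, Rmult_0_r.
      repeat apply Rmult_le_pos; try lra; [apply pow_le; lra | apply Cmod_ge_0].
    + assert (Hzp : 0 < Cmod z) by lra.
      destruct (P_coef_variation a (S k) x y Ha ltac:(lia) Hxy) as [HV0 HV1].
      { split; [unfold y; nra | exact Hy1]. }
      rewrite Rabs_pos_eq by exact HV0.
      (* One factor |w| <= |z| of |w|^(k+1) cancels the denominator: (|z|^2 - |w|^2) / |z| <= 2 (|z|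
         - |w|). *)
      assert (Hlin : (P_coef a (S k) x - P_coef a (S k) y) * Cmod w <= 2 * Cmod (z - w)).
      { apply Rle_trans with ((y - x) / y * Cmod z).
        - apply Rmult_le_compat; assumption.
        - pose proof (Cmod_diff_le z w).
          replace ((y - x) / y * Cmod z) with ((Cmod z - Cmod w) * (1 + Cmod w / Cmod z))
            by (unfold x, y; field; lra).
          assert (Cmod w / Cmod z <= 1).
          { apply Rmult_le_reg_r with (Cmod z); [lra |]. unfold Rdiv. rewrite Rmult_assoc, Rinv_l; lra. }
          nra. }
      replace (Cmod w ^ S k) with (Cmod w * Cmod w ^ k) by reflexivity.
      rewrite <- Rmult_assoc. replace (2 * r ^ k * Cmod (z - w)) with (2 * Cmod (z - w) * r ^ k) by ring.
      apply Rmult_le_compat; [now apply Rmult_le_pos | now apply pow_le | exact Hlin |].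
      apply pow_incr. lra.
Qed.

Lemma antiholo_term_le a k (z : C) : 0 <= a -> Cmod z < 1 ->
  Cmod (antiholo_term a (S k) z) <= / INR (S k) * Cmod z ^ S k.
Proof.
  intros Ha Hz. pose proof (Cmod_ge_0 z).
  destruct (P_coef_bounds a (S k) (Cmod z ^ 2) Ha ltac:(lia) ltac:(nra)) as [HP0 HP1].
  unfold antiholo_term. rewrite Cmod_mult, Cmod_R, Cmod_pow, Cmod_conj, Rabs_pos_eq by exact HP0.
  apply Rmult_le_compat_r; [now apply pow_le | exact HP1].
Qed.

(** * Fourier coefficients *)

Lemma sum_n_tail_le (a : nat -> C) (b : nat -> R) (n m : nat) :
  (forall k, Cmod (a k) <= b k) ->
  Cmod (sum_n (G := C_NormedModule) a (m + n) - sum_n (G := C_NormedModule) a n)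
    <= sum_n b (m + n) - sum_n b n.
Proof.
  intros Hab. induction m as [| m IH].
  - simpl. replace (_ - _)%C with (RtoC 0) by ring. rewrite Cmod_0. lra.
  - simpl. rewrite !sum_Sn. set (x := sum_n (G := C_NormedModule) a (m + n)) in *. set (y := sum_n (G := C_NormedModule) a n) in *.
    change (Cmod (x + a (S (m + n)) - y) <= sum_n b (m + n) + b (S (m + n)) - sum_n b n).
    replace (x + a (S (m + n)) - y)%C with ((x - y) + a (S (m + n)))%C by ring.
    eapply Rle_trans; [apply Cmod_triangle |]. specialize (Hab (S (m + n))). lra.
Qed.

Lemma is_series_Cmod_le (a : nat -> C) (S : C) (B : R) :
  is_series (V := C_NormedModule) a S ->
  (forall n, sum_n (fun k => Cmod (a k)) n <= B) -> Cmod S <= B.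
Proof.
  intros Ha HB.
  refine (is_lim_seq_le (fun n => Cmod (sum_n (G := C_NormedModule) a n)) (fun _ => B) (Cmod S) B _ _ _).
  - intros n. eapply Rle_trans; [| apply (HB n)].
    exact (norm_sum_n_m (V := C_NormedModule) a 0 n).
  - exact (filterlim_comp _ _ _ _ _ _ _ _ Ha (filterlim_norm (V := C_NormedModule) S)).
  - apply is_lim_seq_const.
Qed.

(** The bound depends only on the majorant, so it is uniform over all series sharing that majorant;
    it is applied to trigonometric series with [t] varying. *)
Lemma is_series_tail_le (a : nat -> C) (b : nat -> R) (S : C) (B : R) (n : nat) :
  is_series (V := C_NormedModule) a S -> is_series b B ->
  (forall k, Cmod (a k) <= b k) ->
  Cmod (S - sum_n (G := C_NormedModule) a n) <= B - sum_n b n.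
Proof.
  intros Ha Hb Hab.
  assert (Hb' : is_lim_seq (fun m => sum_n b (m + n) - sum_n b n) (B - sum_n b n)).
  { apply is_lim_seq_minus'; [| apply is_lim_seq_const].
    apply (is_lim_seq_incr_n (sum_n b) n B). exact Hb. }
  assert (Ha' : is_lim_seq (fun m => Cmod (sum_n (G := C_NormedModule) a (m + n)
                    - sum_n (G := C_NormedModule) a n)) (Cmod (S - sum_n (G := C_NormedModule) a n))).
  { apply (is_lim_seq_incr_n (fun m => Cmod (sum_n (G := C_NormedModule) a m
                    - sum_n (G := C_NormedModule) a n)) n).
    refine (filterlim_comp _ _ _ _ _ _ _ _ _
              (filterlim_norm (V := C_NormedModule) (S - sum_n (G := C_NormedModule) a n)%C)).
    refine (filterlim_comp_2 (V := C_NormedModule) (W := C_NormedModule) _ (fun _ => opp (sum_n (G := C_NormedModule) a n))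
       plus Ha (filterlim_const _) (filterlim_plus (V := C_NormedModule) _ _)). }
  refine (is_lim_seq_le _ _ _ _ _ Ha' Hb').
  intros m. now apply sum_n_tail_le.
Qed.

(** [C_R_NormedModule] has real scalars only, so a complex factor is handled through real and
    imaginary parts. *)
Lemma is_RInt_Cmult_l (p l : C) (g : R -> C) (x y : R) :
  is_RInt (V := C_R_NormedModule) g x y l ->
  is_RInt (V := C_R_NormedModule) (fun t => p * g t)%C x y (p * l)%C.
Proof.
  intros Hg. destruct p as [p1 p2].
  pose proof (is_RInt_fct_extend_fst (U := R_NormedModule) (V := R_NormedModule) g x y l Hg) as H1.
  pose proof (is_RInt_fct_extend_snd (U := R_NormedModule) (V := R_NormedModule) g x y l Hg) as H2.
  apply (is_RInt_fct_extend_pair (U := R_NormedModule) (V := R_NormedModule)).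
  - exact (is_RInt_minus _ _ _ _ _ _ (is_RInt_scal _ _ _ p1 _ H1) (is_RInt_scal _ _ _ p2 _ H2)).
  - exact (is_RInt_plus _ _ _ _ _ _ (is_RInt_scal _ _ _ p1 _ H2) (is_RInt_scal _ _ _ p2 _ H1)).
Qed.

(** * Orthogonality of the exponentials and the coefficient bound *)

Lemma sin_cos_period (m : Z) : sin (IZR m * (2 * PI)) = 0 /\ cos (IZR m * (2 * PI)) = 1.
Proof.
  assert (H : sin (IZR m * PI) = 0) by (apply sin_eq_0_1; now exists m).
  replace (IZR m * (2 * PI)) with (2 * (IZR m * PI)) by ring.
  rewrite sin_2a, cos_2a_sin, H. split; ring.
Qed.

Lemma is_RInt_cis (m : Z) :
  is_RInt (V := C_R_NormedModule) (fun t => cis (IZR m * t)) 0 (2 * PI)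
    (if Z.eq_dec m 0 then RtoC (2 * PI) else RtoC 0).
Proof.
  destruct (Z.eq_dec m 0) as [-> | Hm].
  - apply (is_RInt_ext (V := C_R_NormedModule) (fun _ => RtoC 1)).
    + intros t _. unfold cis. now rewrite Rmult_0_l, cos_0, sin_0.
    + pose proof (is_RInt_const (V := C_R_NormedModule) 0 (2 * PI) (RtoC 1)) as H.
      replace (RtoC (2 * PI)) with (scal (V := C_R_NormedModule) (2 * PI - 0) (RtoC 1)); [exact H |].
      unfold scal; simpl; unfold prod_scal; simpl. unfold scal; simpl; unfold mult; simpl.
      unfold RtoC. f_equal; ring.
  - assert (Hm' : IZR m <> 0) by now apply not_0_IZR.
    destruct (sin_cos_period m) as [Hs Hc].
    apply (is_RInt_fct_extend_pair (U := R_NormedModule) (V := R_NormedModule)); simpl.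
    + replace 0 with (minus (sin (IZR m * (2 * PI)) / IZR m) (sin (IZR m * 0) / IZR m)) at 2.
      * apply (is_RInt_derive (V := R_CompleteNormedModule) (fun t => sin (IZR m * t) / IZR m)).
        -- intros t _. auto_derive; [easy |]. field. exact Hm'.
        -- intros t _. apply (ex_derive_continuous (V := R_NormedModule)). auto_derive. easy.
      * rewrite Hs, Rmult_0_r, sin_0. unfold minus, plus, opp; simpl. field. exact Hm'.
    + replace 0 with (minus (- cos (IZR m * (2 * PI)) / IZR m) (- cos (IZR m * 0) / IZR m)) at 2.
      * apply (is_RInt_derive (V := R_CompleteNormedModule) (fun t => - cos (IZR m * t) / IZR m)).
        -- intros t _. auto_derive; [easy |]. field. exact Hm'.
        -- intros t _. apply (ex_derive_continuous (V := R_NormedModule)). auto_derive. easy.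
      * rewrite Hc, Rmult_0_r, cos_0. unfold minus, plus, opp; simpl. field. exact Hm'.
Qed.

Lemma is_RInt_trig_sum (p : nat -> C) (m : nat -> Z) (n : nat) :
  is_RInt (V := C_R_NormedModule)
    (fun t => sum_n (G := C_NormedModule) (fun j => p j * cis (IZR (m j) * t))%C n) 0 (2 * PI)
    (sum_n (G := C_NormedModule)
       (fun j => p j * if Z.eq_dec (m j) 0 then RtoC (2 * PI) else RtoC 0)%C n).
Proof.
  induction n as [| n IH].
  - rewrite sum_O. apply (is_RInt_ext (V := C_R_NormedModule) (fun t => p O * cis (IZR (m O) * t))%C).
    + intros t _. now rewrite sum_O.
    + apply is_RInt_Cmult_l, is_RInt_cis.
  - rewrite sum_Sn.
    apply (is_RInt_ext (V := C_R_NormedModule) (fun t =>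
      sum_n (G := C_NormedModule) (fun j => p j * cis (IZR (m j) * t)) n
      + p (S n) * cis (IZR (m (S n)) * t))%C).
    { intros t _. now rewrite sum_Sn. }
    apply (is_RInt_plus (V := C_R_NormedModule)); [exact IH |].
    apply is_RInt_Cmult_l, is_RInt_cis.
Qed.

Lemma sum_n_all_zero (a : nat -> C) (n : nat) :
  (forall j, (j <= n)%nat -> a j = RtoC 0) -> sum_n (G := C_NormedModule) a n = RtoC 0.
Proof.
  induction n as [| n IH]; intros H.
  - rewrite sum_O. now apply H.
  - rewrite sum_Sn, IH, (H (S n)) by auto. unfold plus; simpl. ring.
Qed.

Lemma sum_n_single (a : nat -> C) (k n : nat) : (k <= n)%nat ->
  (forall j, j <> k -> a j = RtoC 0) -> sum_n (G := C_NormedModule) a n = a k.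
Proof.
  intros Hk Ha. induction n as [| n IH].
  - rewrite sum_O. f_equal. lia.
  - rewrite sum_Sn. destruct (Nat.eq_dec k (S n)) as [-> | Hne].
    + rewrite sum_n_all_zero by (intros; apply Ha; lia). unfold plus; simpl. ring.
    + rewrite IH, (Ha (S n)) by lia. unfold plus; simpl. ring.
Qed.

Lemma Cmod_cis t : Cmod (cis t) = 1.
Proof.
  unfold Cmod, cis; simpl. replace (_ + _) with 1; [apply sqrt_1 |].
  pose proof (sin2_cos2 t) as H. unfold Rsqr in H. lra.
Qed.

Lemma cis_plus s t : (cis s * cis t)%C = cis (s + t).
Proof. unfold cis, Cmult; simpl. rewrite cos_plus, sin_plus. f_equal; ring. Qed.

Lemma cis_pow t k : (cis t ^ k)%C = cis (INR k * t).
Proof.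
  induction k as [| k IH].
  - simpl. unfold cis. now rewrite Rmult_0_l, cos_0, sin_0.
  - rewrite Cpow_S, IH, cis_plus, S_INR. f_equal. ring.
Qed.

Lemma Cconj_cis t : Cconj (cis t) = cis (- t).
Proof. unfold Cconj, cis; simpl. now rewrite cos_neg, sin_neg. Qed.

Lemma norm_C_R (z : C) : norm (V := C_R_NormedModule) z = Cmod z.
Proof.
  unfold norm; simpl; unfold prod_norm, Cmod, norm; simpl; unfold abs; simpl.
  f_equal. rewrite !Rmult_1_r, <- !Rabs_mult, !Rabs_pos_eq; [reflexivity | nra | nra].
Qed.

(** Only finite sums are integrated. Both series are cut at one index n, with tails at most eps / 2
    for every t. The truncated sum has modulus at most M + eps, and its integral against e^(-ikt) is
    2 pi p_k. *)
Lemma trig_coef_le (p q : nat -> C) (M : R) (k : nat) :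
  ex_series (fun j => Cmod (p j)) -> ex_series (fun j => Cmod (q j)) ->
  (forall t, exists S1 S2,
     is_series (V := C_NormedModule) (fun j => p j * cis (IZR (Z.of_nat j) * t))%C S1 /\
     is_series (V := C_NormedModule) (fun j => q j * cis (IZR (- Z.of_nat (S j)) * t))%C S2 /\
     Cmod (S1 + S2) <= M) ->
  Cmod (p k) <= M.
Proof.
  intros [A HA] [B HB] Hser. apply le_epsilon. intros eps Heps.
  assert (exists n, (k <= n)%nat /\ A - sum_n (fun j => Cmod (p j)) n <= eps / 2 /\
            B - sum_n (fun j => Cmod (q j)) n <= eps / 2) as (n & Hkn & HnA & HnB).
  { assert (He : 0 < eps / 2) by lra.
    destruct (proj1 (filterlim_locally _ _) HA (mkposreal _ He)) as [N1 HN1].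
    destruct (proj1 (filterlim_locally _ _) HB (mkposreal _ He)) as [N2 HN2].
    exists (k + N1 + N2)%nat.
    specialize (HN1 (k + N1 + N2)%nat ltac:(lia)). specialize (HN2 (k + N1 + N2)%nat ltac:(lia)).
    change (Rabs (sum_n (fun j => Cmod (p j)) (k + N1 + N2) - A) < eps / 2) in HN1.
    change (Rabs (sum_n (fun j => Cmod (q j)) (k + N1 + N2) - B) < eps / 2) in HN2.
    apply Rabs_def2 in HN1. apply Rabs_def2 in HN2. repeat split; [lia | lra | lra]. }
  (* The frequencies after multiplication by e^(-ikt): [m1] vanishes only at j = k, and [m2] is
     always negative. *)
  set (m1 := fun j => (Z.of_nat j - Z.of_nat k)%Z).
  set (m2 := fun j => (- Z.of_nat (S j) - Z.of_nat k)%Z).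
  pose proof (is_RInt_plus (V := C_R_NormedModule) _ _ _ _ _ _
                (is_RInt_trig_sum p m1 n) (is_RInt_trig_sum q m2 n)) as HI.
  rewrite (sum_n_single (fun j => p j * _)%C k) in HI; [| exact Hkn |].
  2: { intros j Hj. destruct (Z.eq_dec (m1 j) 0); [unfold m1 in *; lia | ring]. }
  rewrite (sum_n_all_zero (fun j => q j * _)%C) in HI.
  2: { intros j Hj. destruct (Z.eq_dec (m2 j) 0); [unfold m2 in *; lia | ring]. }
  destruct (Z.eq_dec (m1 k) 0) as [_ | Hne]; [| unfold m1 in Hne; lia].
  pose proof (is_RInt_const 0 (2 * PI) (M + eps)) as HC.
  assert (HPI : 0 < 2 * PI) by (pose proof PI_RGT_0; lra).
  assert (HL : norm (V := C_R_NormedModule) (plus (p k * RtoC (2 * PI)) (RtoC 0))%C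
                 <= scal (2 * PI - 0) (M + eps)).
  { apply (norm_RInt_le (V := C_R_NormedModule) _ _ _ _ _ _ (Rlt_le _ _ HPI)) with (2 := HI) (3 := HC).
    intros t _. rewrite norm_C_R.
    destruct (Hser t) as (S1 & S2 & HS1 & HS2 & HM).
    pose proof (is_series_tail_le _ _ _ _ n HS1 HA) as HT1.
    pose proof (is_series_tail_le _ _ _ _ n HS2 HB) as HT2.
    assert (Hcis : forall u s, Cmod (u * cis s) <= Cmod u)
      by (intros; rewrite Cmod_mult, Cmod_cis; lra).
    specialize (HT1 (fun j => Hcis _ _)). specialize (HT2 (fun j => Hcis _ _)).
    set (X1 := sum_n (G := C_NormedModule) (fun j => p j * cis (IZR (Z.of_nat j) * t))%C n) in HT1.
    set (X2 := sum_n (G := C_NormedModule) (fun j => q j * cis (IZR (- Z.of_nat (S j)) * t))%C n) in HT2.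
    (* Pulling out the unimodular factor e^(-ikt) recovers the partial sums of the original
       series. *)
    assert (Hrot : forall (r : nat -> C) (m m' : nat -> Z), (forall j, m j = m' j - Z.of_nat k)%Z ->
      sum_n (G := C_NormedModule) (fun j => r j * cis (IZR (m j) * t))%C n =
      (cis (- INR k * t) * sum_n (G := C_NormedModule) (fun j => r j * cis (IZR (m' j) * t)) n)%C).
    { intros r m m' Hm.
      transitivity (sum_n (G := C_NormedModule)
        (fun j => mult (K := C_AbsRing) (cis (- INR k * t)) (r j * cis (IZR (m' j) * t)))%C n).
      - apply sum_n_ext. intros j. unfold mult; simpl.
        rewrite Hm, minus_IZR, <- INR_IZR_INZ.
        replace ((IZR (m' j) - INR k) * t) with (- INR k * t + IZR (m' j) * t) by ring.
        rewrite <- cis_plus. ring.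
      - apply (sum_n_mult_l (K := C_AbsRing)). }
    rewrite (Hrot p m1 (fun j => Z.of_nat j)) by reflexivity.
    rewrite (Hrot q m2 (fun j => - Z.of_nat (S j))%Z) by reflexivity.
    fold X1 X2.
    change (Cmod (cis (- INR k * t) * X1 + cis (- INR k * t) * X2) <= M + eps).
    rewrite <- Cmult_plus_distr_l, Cmod_mult, Cmod_cis, Rmult_1_l.
    replace (X1 + X2)%C with ((S1 + S2) + (- (S1 - X1) + - (S2 - X2)))%C by ring.
    eapply Rle_trans; [apply Cmod_triangle |].
    pose proof (Cmod_triangle (- (S1 - X1)) (- (S2 - X2))) as H3.
    rewrite !Cmod_opp in H3. lra. }
  rewrite norm_C_R in HL.
  change (Cmod (p k * RtoC (2 * PI) + RtoC 0) <= (2 * PI - 0) * (M + eps)) in HL.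
  rewrite Cplus_0_r, Cmod_mult, Cmod_R, Rabs_pos_eq, Rminus_0_r, Rmult_comm in HL by lra.
  now apply Rmult_le_reg_l in HL.
Qed.

(** * Series expansions *)

Ltac C_eq := match goal with |- ?x = ?y => change (@eq C x y) end.

Lemma is_series_Cmod_bounded (a : nat -> C) (S : C) :
  is_series (V := C_NormedModule) a S -> exists B, forall k, Cmod (a k) <= B.
Proof.
  intros Ha.
  destruct (filterlim_bounded (V := C_NormedModule) (sum_n (G := C_NormedModule) a)) as [B HB];
    [now exists S |].
  change (forall n, Cmod (sum_n (G := C_NormedModule) a n) <= B) in HB.
  exists (2 * B). pose proof (Rle_trans _ _ _ (Cmod_ge_0 _) (HB O)) as HB0. intros [| k].
  - specialize (HB O). rewrite sum_O in HB. lra.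
  - pose proof (HB k) as H1. pose proof (HB (Datatypes.S k)) as H2. rewrite sum_Sn in H2.
    set (x := sum_n (G := C_NormedModule) a k) in *.
    change (Cmod (x + a (Datatypes.S k)) <= B) in H2.
    replace (a (Datatypes.S k)) with ((x + a (Datatypes.S k)) + - x)%C by ring.
    eapply Rle_trans; [apply Cmod_triangle |]. rewrite Cmod_opp. lra.
Qed.

Lemma ex_series_Cmod_le_geom (a : nat -> C) (B q : R) : 0 <= q < 1 ->
  (forall k, Cmod (a k) <= B * q ^ k) -> ex_series (fun k => Cmod (a k)).
Proof.
  intros Hq Ha. apply (ex_series_le (V := R_CompleteNormedModule)) with (b := fun k => B * q ^ k).
  - intros k. change (Rabs (Cmod (a k)) <= B * q ^ k). rewrite Rabs_pos_eq; [apply Ha | apply Cmod_ge_0].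
  - apply (ex_series_scal (V := R_NormedModule) B). apply ex_series_geom. rewrite Rabs_pos_eq; lra.
Qed.

(** The two halves of the expansion, with c_k as [u k] and c_(-k) as [v k]; the index [S j] starts
    the second half at k = 1. *)
Definition harmonic_series (a : R) (u v : nat -> C) (f : C -> C) : Prop :=
  forall z, Cmod z < 1 -> exists S1 S2 : C,
    is_series (V := C_NormedModule) (fun k => u k * z ^ k)%C S1 /\
    is_series (V := C_NormedModule) (fun j => v (S j) * antiholo_term a (S j) z)%C S2 /\
    f z = (S1 + S2)%C.

(** The growth k - 1 allowed for c_(-k) is absorbed by P_k <= 1 / k, whence coefficient 1 in front
    of |z|^k. *)
Lemma antiholo_coef_le a (v : nat -> C) k z : 0 <= a -> Cmod z < 1 ->
  Cmod (v (S k)) <= INR k -> Cmod (v (S k) * antiholo_term a (S k) z) <= Cmod z ^ S k.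
Proof.
  intros Ha Hz Hv. rewrite Cmod_mult.
  pose proof (antiholo_term_le a k z Ha Hz) as H.
  assert (HS : 0 < INR (S k)) by (apply lt_0_INR; lia).
  apply Rle_trans with (INR k * (/ INR (S k) * Cmod z ^ S k)).
  - apply Rmult_le_compat; auto using Cmod_ge_0.
  - rewrite <- Rmult_assoc. rewrite <- (Rmult_1_l (Cmod z ^ S k)) at 2.
    apply Rmult_le_compat_r; [apply pow_le, Cmod_ge_0 |].
    apply Rmult_le_reg_r with (INR (S k)); [exact HS |].
    rewrite Rmult_assoc, Rinv_l, S_INR by lra. lra.
Qed.

(** On the circle of radius r the function is a trigonometric series with coefficients u_k r^k at
    nonnegative frequencies. Hence |u_k| r^k <= M, and r tends to 1. *)
Lemma harmonic_coef_le a (u v : nat -> C) (f : C -> C) (M : R) : 0 <= a ->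
  harmonic_series a u v f -> (forall k, Cmod (v (S k)) <= INR k) ->
  (forall z, Cmod z < 1 -> Cmod (f z) <= M) ->
  forall k, Cmod (u k) <= M.
Proof.
  intros Ha Hf Hv HM k.
  assert (Hr : forall r, 0 < r < 1 -> Cmod (u k) * r ^ k <= M).
  { intros r Hr.
    replace (Cmod (u k) * r ^ k) with (Cmod (u k * RtoC r ^ k)).
    2: { rewrite Cmod_mult, Cmod_pow, Cmod_R, Rabs_pos_eq; lra. }
    assert (Hz : forall t, Cmod (RtoC r * cis t) = r)
      by (intros; rewrite Cmod_mult, Cmod_cis, Cmod_R, Rabs_pos_eq; lra).
    apply (trig_coef_le (fun j => u j * RtoC r ^ j)%C
             (fun j => v (S j) * (P_coef a (S j) (r ^ 2) * r ^ S j))%C).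
    (* Convergence at a larger radius r' bounds |u_j| r'^j, so at radius r the terms decay with
       ratio r / r'. *)
    - set (r' := (1 + r) / 2). assert (Hr' : r < r' < 1) by (unfold r'; lra).
      destruct (Hf (RtoC r')) as (S1 & _ & HS1 & _).
      { rewrite Cmod_R, Rabs_pos_eq; lra. }
      destruct (is_series_Cmod_bounded _ _ HS1) as [B HB].
      apply (ex_series_Cmod_le_geom _ B (r / r')).
      + split; [apply Rdiv_le_0_compat; lra |]. apply Rmult_lt_reg_r with r'; [lra |].
        unfold Rdiv. rewrite Rmult_assoc, Rinv_l; lra.
      + intros j. specialize (HB j).
        rewrite Cmod_mult, Cmod_pow, Cmod_R, Rabs_pos_eq in HB |- * by lra.
        replace (r ^ j) with (r' ^ j * (r / r') ^ j)
          by (rewrite <- Rpow_mult_distr; f_equal; field; lra).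
        rewrite <- Rmult_assoc. apply Rmult_le_compat_r; [| exact HB].
        apply pow_le, Rdiv_le_0_compat; lra.
    - apply (ex_series_Cmod_le_geom _ r r); [lra |]. intros j.
      pose proof (antiholo_coef_le a v j (RtoC r) Ha) as Hj.
      unfold antiholo_term in Hj. rewrite Cmod_R, Rabs_pos_eq in Hj by lra.
      replace (Cconj r) with (RtoC r) in Hj by (unfold Cconj, RtoC; simpl; now rewrite Ropp_0).
      apply Hj; [lra | apply Hv].
    - intros t. destruct (Hf (r * cis t)%C) as (S1 & S2 & HS1 & HS2 & HS).
      { rewrite Hz; lra. }
      exists S1, S2. split; [| split].
      + revert HS1. apply is_series_ext. intros j. C_eq.
        rewrite Cpow_mult_l, cis_pow, <- INR_IZR_INZ. ring.
      + revert HS2. apply is_series_ext. intros j. C_eq.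
        unfold antiholo_term.
        rewrite Hz, Cmult_conj, Cconj_cis, Cpow_mult_l, cis_pow.
        replace (IZR (- Z.of_nat (S j)) * t) with (INR (S j) * - t)
          by (rewrite opp_IZR, <- INR_IZR_INZ; ring).
        replace (Cconj r) with (RtoC r) by (unfold Cconj, RtoC; simpl; now rewrite Ropp_0).
        ring.
      + rewrite <- HS. apply HM. rewrite Hz. lra. }
  apply le_epsilon. intros eps Heps. pose proof (Cmod_ge_0 (u k)) as Hc. pose proof (pos_INR k) as Hk.
  set (X := Cmod (u k)) in *. assert (HX : 0 <= X * INR k) by now apply Rmult_le_pos.
  (* The limit r -> 1 taken by hand: at r = 1 - d, Bernoulli's inequality bounds the loss by X k d,
     and this d lies in (0, 1) and keeps the loss below [eps]. *)
  set (d := eps / (X * INR k + eps + 1)).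
  assert (Hd : 0 < d < 1 /\ X * INR k * d <= eps).
  { unfold d. assert (0 < X * INR k + eps + 1) by lra.
    assert (Hd0 : 0 < / (X * INR k + eps + 1)) by now apply Rinv_0_lt_compat.
    assert (Hd1 : / (X * INR k + eps + 1) * (X * INR k + eps + 1) = 1) by (apply Rinv_l; lra).
    set (w := / (X * INR k + eps + 1)) in *. unfold Rdiv. fold w.
    repeat split; nra. }
  specialize (Hr (1 - d) ltac:(lra)).
  pose proof (one_sub_pow_le (1 - d) k ltac:(lra)) as Hp.
  apply (Rmult_le_compat_l X) in Hp; [| exact Hc]. nra.
Qed.

(** * Bounds for the terms of index at least two *)

Lemma sum_n_geom_le q n : 0 <= q < 1 -> sum_n (fun j => q ^ j) n <= / (1 - q).
Proof.
  intros Hq. assert (H : (1 - q) * sum_n (fun j => q ^ j) n = 1 - q ^ S n).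
  { induction n as [| n IH]; [rewrite sum_O; simpl; ring |].
    rewrite sum_Sn. unfold plus; simpl in *. rewrite Rmult_plus_distr_l, IH. ring. }
  apply Rmult_le_reg_l with (1 - q); [lra |]. rewrite H, Rinv_r by lra.
  pose proof (pow_le q (S n) (proj1 Hq)). lra.
Qed.

(** The partial sums of the differentiated geometric series have a closed form, proved by induction
    in [H]; its negative remainder is dropped. *)
Lemma sum_n_arith_geom_le q n : 0 <= q < 1 ->
  sum_n (fun j => (INR j + 1) * q ^ j) n <= / (1 - q) ^ 2.
Proof.
  intros Hq. assert (H : (1 - q) ^ 2 * sum_n (fun j => (INR j + 1) * q ^ j) n
                 = 1 - q ^ S n * ((1 - q) * (INR n + 1) + 1)).
  { induction n as [| n IH]; [rewrite sum_O; simpl; ring |].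
    rewrite sum_Sn, S_INR. unfold plus; simpl AbelianMonoid.plus. cbn -[pow INR sum_n] in *.
    rewrite Rmult_plus_distr_l, IH. simpl. ring. }
  apply Rmult_le_reg_l with ((1 - q) ^ 2); [apply pow_lt; lra |].
  rewrite H, Rinv_r by (apply pow_nonzero; lra).
  pose proof (pow_le q (S n) (proj1 Hq)). pose proof (pos_INR n).
  assert (0 <= q ^ S n * ((1 - q) * (INR n + 1) + 1)); [| lra].
  apply Rmult_le_pos; [assumption | nra].
Qed.

Lemma is_series_only_head (a : nat -> C) (S : C) :
  is_series (V := C_NormedModule) a S -> (forall k, a (Datatypes.S k) = RtoC 0) -> S = a O.
Proof.
  intros Ha H0. apply (filterlim_locally_unique (V := C_NormedModule) (F := eventually)
    (sum_n (G := C_NormedModule) a)); [exact Ha |].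
  apply filterlim_ext with (fun _ => a O); [| apply filterlim_const].
  intros n. symmetry. apply sum_n_single; [lia |]. intros [| j] Hj; [congruence | apply H0].
Qed.

Lemma harmonic_coef_0 a u v f : harmonic_series a u v f -> v 1%nat = RtoC 0 -> u O = f (RtoC 0).
Proof.
  intros Hf Hv. destruct (Hf (RtoC 0)) as (S1 & S2 & HS1 & HS2 & ->); [rewrite Cmod_0; lra |].
  apply is_series_only_head in HS1; [| intros; simpl; ring].
  apply is_series_only_head in HS2.
  - rewrite HS1, HS2, Hv. simpl. ring.
  - intros k. unfold antiholo_term.
    replace (Cconj (RtoC 0)) with (RtoC 0) by (unfold Cconj, RtoC; simpl; now rewrite Ropp_0).
    simpl. ring.
Qed.

(** The holomorphic and antiholomorphic terms of index j + 2 taken together; their series is the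
    nonlinear part h of f. *)
Definition higher_term (a : R) (u v : nat -> C) (z : C) (j : nat) : C :=
  (u (S (S j)) * z ^ S (S j) + v (S (S j)) * antiholo_term a (S (S j)) z)%C.

Lemma is_series_higher_terms a u v f z :
  harmonic_series a u v f -> u O = RtoC 0 -> v 1%nat = RtoC 0 -> Cmod z < 1 ->
  is_series (V := C_NormedModule) (higher_term a u v z) (f z - u 1%nat * z)%C.
Proof.
  intros Hf Hu Hv Hz. destruct (Hf z Hz) as (S1 & S2 & HS1 & HS2 & ->).
  replace (S1 + S2 - u 1%nat * z)%C with (plus (G := C_NormedModule) (S1 - u 1%nat * z)%C S2)
    by (C_eq; unfold plus; simpl; ring).
  apply (is_series_plus (V := C_NormedModule)).
  (* The holomorphic series loses its terms of index 0 and 1; the other one, which starts at index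
     1, loses only its first term. *)
  - apply (is_series_incr_1 (V := C_NormedModule) (fun k => u (S k) * z ^ S k)%C).
    apply (is_series_incr_1 (V := C_NormedModule) (fun k => u k * z ^ k)%C).
    replace (plus _ _) with S1; [exact HS1 |].
    change (@eq C S1 (S1 - u 1%nat * z + u 1%nat * z ^ 1 + u 0%nat * z ^ 0)%C). rewrite Hu. simpl. ring.
  - apply (is_series_incr_1 (V := C_NormedModule) (fun k => v (S k) * antiholo_term a (S k) z)%C).
    replace (plus _ _) with S2; [exact HS2 |].
    change (@eq C S2 (S2 + v 1%nat * antiholo_term a 1 z)%C). rewrite Hv. ring.
Qed.

(** The pair of index k contributes at most (M + 1) |z|^k, with M from u_k and 1 from
    [antiholo_coef_le]; a geometric series remains. *)
Lemma perturbation_le a u v f M z : 0 <= a ->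
  harmonic_series a u v f -> u O = RtoC 0 -> v 1%nat = RtoC 0 ->
  (forall k, Cmod (u k) <= M) -> (forall k, Cmod (v (S k)) <= INR k) -> Cmod z < 1 ->
  Cmod (f z - u 1%nat * z) <= (M + 1) * Cmod z ^ 2 / (1 - Cmod z).
Proof.
  intros Ha Hf Hu0 Hv1 Hu Hv Hz. pose proof (Cmod_ge_0 z) as Hz0.
  pose proof (Rle_trans _ _ _ (Cmod_ge_0 _) (Hu O)) as HM.
  apply (is_series_Cmod_le _ _ _ (is_series_higher_terms a u v f z Hf Hu0 Hv1 Hz)).
  intros n. apply Rle_trans with (sum_n (fun j => ((M + 1) * Cmod z ^ 2) * Cmod z ^ j) n).
  - apply sum_n_m_le. intros j. unfold higher_term.
    eapply Rle_trans; [apply Cmod_triangle |].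
    pose proof (antiholo_coef_le a v (S j) z Ha Hz (Hv (S j))) as H1.
    rewrite Cmod_mult, Cmod_pow.
    assert (H2 : Cmod (u (S (S j))) * Cmod z ^ S (S j) <= M * Cmod z ^ S (S j)).
    { apply Rmult_le_compat_r; [now apply pow_le | apply Hu]. }
    replace ((M + 1) * Cmod z ^ 2 * Cmod z ^ j) with (M * Cmod z ^ S (S j) + Cmod z ^ S (S j))
      by (simpl; ring). lra.
  - rewrite (sum_n_mult_l (K := R_AbsRing) ((M + 1) * Cmod z ^ 2)).
    unfold Rdiv. apply Rmult_le_compat_l.
    + apply Rmult_le_pos; [lra | apply pow2_ge_0].
    + apply sum_n_geom_le. lra.
Qed.

(** The pair of index k has Lipschitz constant M k r^(k-1) + 3 (k - 1) r^(k-1). Over k >= 2, the sum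
    of k r^(k-1) is 1 / (1 - r)^2 - 1, and that of (k - 1) r^(k-1) is r / (1 - r)^2. *)
Lemma perturbation_lip a u v f M r z w : 0 <= a ->
  harmonic_series a u v f -> u O = RtoC 0 -> v 1%nat = RtoC 0 ->
  (forall k, Cmod (u k) <= M) -> (forall k, Cmod (v (S k)) <= INR k) ->
  Cmod z <= r -> Cmod w <= r -> r < 1 ->
  Cmod ((f z - u 1%nat * z) - (f w - u 1%nat * w)) <=
    (M * (/ (1 - r) ^ 2 - 1) + 3 * (r / (1 - r) ^ 2)) * Cmod (z - w).
Proof.
  intros Ha Hf Hu0 Hv1 Hu Hv Hz Hw Hr. pose proof (Cmod_ge_0 z) as Hz0.
  pose proof (Rle_trans _ _ _ (Cmod_ge_0 _) (Hu O)) as HM.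
  pose proof (is_series_minus _ _ _ _
     (is_series_higher_terms a u v f z Hf Hu0 Hv1 (Rle_lt_trans _ _ _ Hz Hr))
     (is_series_higher_terms a u v f w Hf Hu0 Hv1 (Rle_lt_trans _ _ _ Hw Hr))) as Hs.
  apply (is_series_Cmod_le _ _ _ Hs). clear Hs. intros n.
  apply Rle_trans with
    (sum_n (fun j => (M * ((INR (S j) + 1) * r ^ S j) + 3 * (r * ((INR j + 1) * r ^ j))) * Cmod (z - w)) n).
  - apply sum_n_m_le. intros j.
    match goal with |- _ <= ?b => change (Cmod (higher_term a u v z j - higher_term a u v w j) <= b) end.
    replace (higher_term a u v z j - higher_term a u v w j)%C with
      (u (S (S j)) * (z ^ S (S j) - w ^ S (S j))
        + v (S (S j)) * (antiholo_term a (S (S j)) z - antiholo_term a (S (S j)) w))%C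
      by (unfold higher_term; ring).
    eapply Rle_trans; [apply Cmod_triangle |]. rewrite !Cmod_mult.
    assert (H1 : Cmod (u (S (S j))) * Cmod (z ^ S (S j) - w ^ S (S j)) <=
                 M * (INR (S (S j)) * r ^ S j * Cmod (z - w))).
    { apply Rmult_le_compat; auto using Cmod_ge_0, Cpow_diff_le. }
    assert (H2 : Cmod (v (S (S j))) * Cmod (antiholo_term a (S (S j)) z - antiholo_term a (S (S j)) w)
              <= INR (S j) * (3 * r ^ S j * Cmod (z - w))).
    { apply Rmult_le_compat; auto using Cmod_ge_0, antiholo_term_lip. }
    rewrite (S_INR (S j)) in H1. rewrite (S_INR j) in H2 at 1.
    replace ((M * ((INR (S j) + 1) * r ^ S j) + 3 * (r * ((INR j + 1) * r ^ j))) * Cmod (z - w))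
      with (M * ((INR (S j) + 1) * r ^ S j * Cmod (z - w)) + (INR j + 1) * (3 * r ^ S j * Cmod (z - w)))
      by (simpl pow; ring). lra.
  - rewrite (sum_n_mult_r (K := R_AbsRing) (Cmod (z - w))).
    apply Rmult_le_compat_r; [apply Cmod_ge_0 |].
    assert (Hshift : forall m, sum_n (fun j => M * ((INR (S j) + 1) * r ^ S j) + 3 * (r * ((INR j + 1) * r ^ j))) m
      = M * (sum_n (fun j => (INR j + 1) * r ^ j) (S m) - 1) + 3 * (r * sum_n (fun j => (INR j + 1) * r ^ j) m)).
    (* The first sum is the arithmetic-geometric one without its initial term 1. *)
    { induction m as [| m IH].
      - rewrite sum_Sn, !sum_O. unfold plus; simpl. ring.
      - rewrite sum_Sn, IH, (sum_Sn _ (S m)), (sum_Sn _ m). unfold plus; simpl. ring. }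
    rewrite Hshift.
    pose proof (sum_n_arith_geom_le r (S n) ltac:(lra)) as H1.
    pose proof (sum_n_arith_geom_le r n ltac:(lra)) as H2.
    apply Rplus_le_compat.
    + apply Rmult_le_compat_l; lra.
    + apply Rmult_le_compat_l; [lra |]. unfold Rdiv. apply Rmult_le_compat_l; lra.
Qed.

(** * Lipschitz perturbations of linear maps *)

(** Banach's theorem on a closed disk: the iterates from 0 stay in the disk, and their increments
    are dominated by a geometric series, so they converge. *)
Lemma contraction_fixed_point (T : C -> C) (r q : R) : 0 <= r -> 0 <= q < 1 ->
  (forall z, Cmod z <= r -> Cmod (T z) <= r) ->
  (forall z w, Cmod z <= r -> Cmod w <= r -> Cmod (T z - T w) <= q * Cmod (z - w)) ->
  exists z, Cmod z <= r /\ T z = z.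
Proof.
  intros Hr Hq Hmap Hlip. set (x := fun n => Nat.iter n T (RtoC 0)).
  assert (Hx : forall n, Cmod (x n) <= r).
  { induction n as [| n IH]; [simpl; rewrite Cmod_0; lra | now apply Hmap]. }
  assert (Hd : forall n, Cmod (x (S n) - x n) <= Cmod (x 1%nat - x O) * q ^ n).
  { induction n as [| n IH]; [simpl; lra |].
    eapply Rle_trans; [apply (Hlip (x (S n)) (x n)); apply Hx |].
    simpl pow. nra. }
  destruct (ex_series_le (V := C_CompleteNormedModule) (fun n => x (S n) - x n)%C
              (fun n => Cmod (x 1%nat - x O) * q ^ n)) as [l Hl].
  { exact Hd. }
  { apply (ex_series_scal (V := R_NormedModule) (Cmod (x 1%nat - x O)) (fun n => q ^ n)).
    apply ex_series_geom. rewrite Rabs_pos_eq; lra. }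
  assert (Hsum : forall n, sum_n (G := C_NormedModule) (fun n => x (S n) - x n)%C n = x (S n)).
  { induction n as [| n IH].
    - rewrite sum_O. change (@eq C (x 1%nat - RtoC 0)%C (x 1%nat)). ring.
    - rewrite sum_Sn, IH. change (@eq C (x (S n) + (x (S (S n)) - x (S n)))%C (x (S (S n)))). ring. }
  assert (Hlim : filterlim (fun n => x (S n)) eventually (locally (T := C_NormedModule) l)).
  { apply filterlim_ext with (2 := Hl). exact Hsum. }
  assert (He : is_lim_seq (fun n => Cmod (x (S n) - l)) 0).
  { rewrite <- Cmod_0. replace (RtoC 0) with (l - l)%C by ring.
    refine (filterlim_comp _ _ _ _ (fun w : C => Cmod w) _ _ _ _
              (filterlim_norm (V := C_NormedModule) (l - l)%C)).
    exact (filterlim_comp_2 (V := C_NormedModule) (W := C_NormedModule) _ (fun _ => opp l)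
       plus Hlim (filterlim_const _) (filterlim_plus (V := C_NormedModule) _ _)). }
  assert (Hlr : Cmod l <= r).
  { refine (is_lim_seq_le (fun n => Cmod (x (S n))) (fun _ => r) (Cmod l) r _ _ (is_lim_seq_const r)).
    - intros; apply Hx.
    - exact (filterlim_comp _ _ _ _ _ _ _ _ Hlim (filterlim_norm (V := C_NormedModule) l)). }
  exists l. split; [exact Hlr |].
  (* For every iterate x this distance is at most q |x - l| + |T x - l|, which tends to 0. *)
  assert (Cmod (T l - l) <= 0).
  { refine (is_lim_seq_le (fun _ => Cmod (T l - l))
              (fun n => q * Cmod (x (S n) - l) + Cmod (x (S (S n)) - l)) (Cmod (T l - l)) 0
              _ (is_lim_seq_const _) _).
    - intros n. replace (T l - l)%C with (- (T (x (S n)) - T l) + (x (S (S n)) - l))%C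
        by (change (x (S (S n))) with (T (x (S n))); ring).
      eapply Rle_trans; [apply Cmod_triangle |]. rewrite Cmod_opp.
      apply Rplus_le_compat_r, Hlip; auto.
    - replace (Finite 0) with (Finite (q * 0 + 0)) by (f_equal; ring).
      apply is_lim_seq_plus'.
      + now apply (is_lim_seq_scal_l _ q 0).
      + now apply (is_lim_seq_incr_1 (fun n => Cmod (x (S n) - l))). }
  pose proof (Cmod_ge_0 (T l - l)).
  replace (T l) with ((T l - l) + l)%C by ring.
  rewrite (Cmod_eq_0 (T l - l)) by lra. ring.
Qed.

(** The balls of the underlying uniform structure are squares; they are comparable with round disks
    up to a factor sqrt 2 <= 2. *)
Lemma C_openP (U : C -> Prop) : open U <->
  forall x, U x -> exists d, 0 < d /\ forall y, Cmod (y - x) < d -> U y.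
Proof.
  split; intros H x Hx.
  - destruct (H x Hx) as [d Hd]. exists d. split; [apply cond_pos |].
    intros y Hy. now apply Hd, C_NormedModule_mixin_compat1.
  - destruct (H x Hx) as (d & Hd0 & Hd). assert (Hd2 : 0 < d / 2) by lra.
    exists (mkposreal _ Hd2). intros y Hy. apply Hd.
    eapply Rlt_le_trans; [exact (C_NormedModule_mixin_compat2 _ _ _ Hy) |]. simpl.
    pose proof sqrt2_neq_0. assert (sqrt 2 <= 2); [| nra].
    rewrite <- (sqrt_square 2) at 2 by lra. apply sqrt_le_1; lra.
Qed.

(** Let m be the supremum of the times at which the path is in A. If g(m) is in A, then m = 1 puts w
    in both sets, or the path stays in A beyond m. If g(m) is in B, then so is the path just before
    m, and m is not the least bound. *)
Lemma path_connected (U : C -> Prop) :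
  (forall z w, U z -> U w -> exists g : R -> C, g 0 = z /\ g 1 = w /\
     (forall t, 0 <= t <= 1 -> U (g t)) /\
     exists K, 0 < K /\ forall s t, 0 <= s <= 1 -> 0 <= t <= 1 -> Cmod (g s - g t) <= K * Rabs (s - t)) ->
  connected_set U.
Proof.
  intros Hpath A B HA HB Hcov (z & Uz & Az) (w & Uw & Bw).
  destruct (Hpath z w Uz Uw) as (g & Hg0 & Hg1 & HgU & K & HK & Hg).
  apply Classical_Prop.NNPP. intros Hno.
  assert (Hexcl : forall t, 0 <= t <= 1 -> A (g t) -> B (g t) -> False).
  { intros t Ht H1 H2. apply Hno. exists (g t). auto. }
  assert (Hnear : forall V t, open V -> 0 <= t <= 1 -> V (g t) ->
            exists d, 0 < d /\ forall s, 0 <= s <= 1 -> Rabs (s - t) < d -> V (g s)).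
  { intros V t HV Ht Vt. destruct (proj1 (C_openP V) HV _ Vt) as (d & Hd & HVd).
    exists (d / K). split; [now apply Rdiv_lt_0_compat |]. intros s Hs Hst. apply HVd.
    eapply Rle_lt_trans; [now apply Hg |].
    apply (Rmult_lt_compat_l K) in Hst; [| exact HK].
    replace (K * (d / K)) with d in Hst by (field; lra). exact Hst. }
  destruct (completeness (fun t => 0 <= t <= 1 /\ A (g t))) as [m [Hub Hlub]].
  { exists 1. intros t [Ht _]. lra. }
  { exists 0. rewrite Hg0. split; [lra | exact Az]. }
  assert (Hm0 : 0 <= m) by (apply Hub; rewrite Hg0; split; [lra | exact Az]).
  assert (Hm1 : m <= 1) by (apply Hlub; intros t [Ht _]; lra).
  destruct (Hcov (g m) (HgU m ltac:(lra))) as [Am | Bm].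
  - destruct (Hnear A m HA ltac:(lra) Am) as (d & Hd & HAd).
    destruct (Rle_lt_dec 1 m) as [H1m | H1m].
    { replace m with 1 in Am by lra. apply (Hexcl 1 ltac:(lra) Am). now rewrite Hg1. }
    set (e := Rmin (d / 2) (1 - m)).
    assert (He : 0 < e) by (apply Rmin_pos; lra).
    assert (He1 : e <= d / 2) by apply Rmin_l. assert (He2 : e <= 1 - m) by apply Rmin_r.
    assert (m + e <= m); [| lra].
    apply Hub. split; [lra |]. apply HAd; [lra |]. apply Rabs_def1; lra.
  - destruct (Hnear B m HB ltac:(lra) Bm) as (d & Hd & HBd).
    assert (m <= m - d / 2); [| lra].
    apply Hlub. intros t [Ht At]. apply Rnot_lt_le. intros Hlt.
    assert (t <= m) by (apply Hub; auto).
    apply (Hexcl t Ht At). apply HBd; [exact Ht |]. apply Rabs_def1; lra.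
Qed.

Lemma Cmod_segment_lt (z w : C) (r t : R) : Cmod z < r -> Cmod w < r -> 0 <= t <= 1 ->
  Cmod (RtoC (1 - t) * z + RtoC t * w) < r.
Proof.
  intros Hz Hw Ht. eapply Rle_lt_trans; [apply Cmod_triangle |].
  rewrite !Cmod_mult, !Cmod_R, !Rabs_pos_eq by lra.
  apply Rle_lt_trans with (Rmax (Cmod z) (Cmod w)); [| now apply Rmax_lub_lt].
  pose proof (Rmax_l (Cmod z) (Cmod w)). pose proof (Rmax_r (Cmod z) (Cmod w)). nra.
Qed.

(** The reverse triangle inequality for f(z) = b z + h(z). It yields both injectivity and a
    Lipschitz inverse. *)
Lemma lipschitz_perturbation_expanding (f : C -> C) (b : C) (r L : R) : L < Cmod b ->
  (forall z w, Cmod z <= r -> Cmod w <= r ->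
     Cmod ((f z - b * z) - (f w - b * w)) <= L * Cmod (z - w)) ->
  forall z w, Cmod z <= r -> Cmod w <= r -> (Cmod b - L) * Cmod (z - w) <= Cmod (f z - f w).
Proof.
  intros HL Hlip z w Hz Hw. specialize (Hlip z w Hz Hw).
  pose proof (Cmod_triangle (f z - f w) (- ((f z - b * z) - (f w - b * w)))) as H.
  replace (f z - f w + - ((f z - b * z) - (f w - b * w)))%C with (b * (z - w))%C in H by ring.
  rewrite Cmod_opp, Cmod_mult in H. lra.
Qed.

Lemma lipschitz_perturbation_univalent (f : C -> C) (b : C) (r L : R) : L < Cmod b ->
  (forall z w, Cmod z <= r -> Cmod w <= r ->
     Cmod ((f z - b * z) - (f w - b * w)) <= L * Cmod (z - w)) ->
  univalent_on (disk r) f.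
Proof.
  unfold disk. intros HL Hlip z w Hz Hw Heq.
  pose proof (lipschitz_perturbation_expanding f b r L HL Hlip z w ltac:(lra) ltac:(lra)) as Hexp.
  replace (f z - f w)%C with (RtoC 0) in Hexp by (rewrite Heq; ring).
  rewrite Cmod_0 in Hexp. pose proof (Cmod_ge_0 (z - w)).
  assert (E : (z - w)%C = 0) by (apply Cmod_eq_0; nra).
  replace z with (z - w + w)%C by ring. rewrite E. ring.
Qed.

(** [H] bounds h on the closed disk, so R0 + H <= |b| r makes z |-> (w - h(z)) / b send the closed
    disk into the open one; hence its fixed point is interior. *)
Lemma disk_in_image_of_lipschitz_perturbation (f : C -> C) (b : C) (r L H R0 : R) :
  0 < r -> 0 < R0 -> 0 <= L < Cmod b ->
  (forall z w, Cmod z <= r -> Cmod w <= r ->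
     Cmod ((f z - b * z) - (f w - b * w)) <= L * Cmod (z - w)) ->
  (forall z, Cmod z <= r -> Cmod (f z - b * z) <= H) -> R0 + H <= Cmod b * r ->
  univalent_disk_in_image f r R0.
Proof.
  intros Hr HR0 HL Hlip HH HRH.
  assert (Hb : b <> RtoC 0) by (apply Cmod_gt_0; lra).
  pose proof (lipschitz_perturbation_expanding f b r L (proj2 HL) Hlip) as Hexp.
  pose proof (lipschitz_perturbation_univalent f b r L (proj2 HL) Hlip) as Hinj.
  (* The existential comes before the condition on w so that choice later gives a total inverse; 0
     is a dummy value when |w| >= R0. *)
  assert (Hsurj : forall w, exists z, Cmod w < R0 -> Cmod z < r /\ f z = w).
  { intros w. destruct (Rlt_dec (Cmod w) R0) as [Hw | Hw]; [| now exists (RtoC 0)].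
    assert (Hmap : forall z, Cmod z <= r -> Cmod ((w - (f z - b * z)) / b) < r).
    { intros z Hz. rewrite Cmod_div by exact Hb.
      apply Rmult_lt_reg_r with (Cmod b); [lra |].
      unfold Rdiv. rewrite Rmult_assoc, Rinv_l, Rmult_1_r by lra.
      eapply Rle_lt_trans; [apply Cmod_triangle |]. rewrite Cmod_opp. specialize (HH z Hz). lra. }
    destruct (contraction_fixed_point (fun z => (w - (f z - b * z)) / b)%C r (L / Cmod b))
      as (z & Hz & Hfix).
    - lra.
    - split; [apply Rdiv_le_0_compat; lra |]. apply Rmult_lt_reg_r with (Cmod b); [lra |].
      unfold Rdiv. rewrite Rmult_assoc, Rinv_l; lra.
    - intros z Hz. left. now apply Hmap.
    - intros z1 z2 H1 H2.
      replace ((w - (f z1 - b * z1)) / b - (w - (f z2 - b * z2)) / b)%C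
        with (- ((f z1 - b * z1) - (f z2 - b * z2)) / b)%C by (field; exact Hb).
      rewrite Cmod_div, Cmod_opp by exact Hb. specialize (Hlip z1 z2 H1 H2).
      replace (L / Cmod b * Cmod (z1 - z2)) with (L * Cmod (z1 - z2) * / Cmod b) by (field; lra).
      apply Rmult_le_compat_r; [left; apply Rinv_0_lt_compat; lra | exact Hlip].
    - exists z. intros _. split.
      + rewrite <- Hfix. now apply Hmap.
      + replace (f z) with (w - b * ((w - (f z - b * z)) / b) + b * z)%C by (field; exact Hb).
        rewrite Hfix. ring. }
  set (U := fun z => Cmod z < r /\ Cmod (f z) < R0).
  exists U. split; [split; [| split] | split; [| split]].
  - apply C_openP. intros x [Hx Hfx].
    (* A Lipschitz constant of f on the closed disk. *)
    set (K := Cmod b + L). assert (HK : 0 < K) by (unfold K; lra).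
    exists (Rmin (r - Cmod x) ((R0 - Cmod (f x)) / K)). split.
    { apply Rmin_pos; [lra |]. apply Rdiv_lt_0_compat; lra. }
    intros y Hy. pose proof (Rlt_le_trans _ _ _ Hy (Rmin_l _ _)) as Hy1.
    pose proof (Rlt_le_trans _ _ _ Hy (Rmin_r _ _)) as Hy2.
    pose proof (Cmod_diff_le y x) as Hyx.
    split; [lra |].
    apply (Rmult_lt_compat_l K) in Hy2; [| exact HK].
    replace (K * ((R0 - Cmod (f x)) / K)) with (R0 - Cmod (f x)) in Hy2 by (field; lra).
    specialize (Hlip y x ltac:(lra) ltac:(lra)).
    pose proof (Cmod_triangle (f x + b * (y - x)) ((f y - b * y) - (f x - b * x))) as H1.
    replace (f x + b * (y - x) + ((f y - b * y) - (f x - b * x)))%C with (f y) in H1 by ring.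
    pose proof (Cmod_triangle (f x) (b * (y - x))) as H2. rewrite Cmod_mult in H2.
    unfold K in Hy2. lra.
  - apply path_connected. intros z w [Hz Hfz] [Hw Hfw].
    (* Here [h] is an inverse of f, and the path from z to w is the image under [h] of the segment
       from f(z) to f(w). *)
    destruct (functional_choice _ Hsurj) as [h Hh].
    set (seg := fun t => (RtoC (1 - t) * f z + RtoC t * f w)%C).
    assert (Hseg : forall t, 0 <= t <= 1 -> Cmod (seg t) < R0)
      by (intros; now apply Cmod_segment_lt).
    exists (fun t => h (seg t)).
    destruct (Hh (seg 0) (Hseg 0 ltac:(lra))) as [A1 A2].
    destruct (Hh (seg 1) (Hseg 1 ltac:(lra))) as [B1 B2].
    split; [| split; [| split]].
    + apply Hinj; [assumption | assumption |]. rewrite A2. unfold seg.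
      replace (1 - 0) with 1 by ring. ring.
    + apply Hinj; [assumption | assumption |]. rewrite B2. unfold seg.
      replace (1 - 1) with 0 by ring. ring.
    + intros t Ht. destruct (Hh (seg t) (Hseg t Ht)) as [C1 C2].
      split; [exact C1 | rewrite C2; now apply Hseg].
    (* The inverse has Lipschitz constant 1 / (|b| - L); adding 1 keeps the constant positive when
       f(z) = f(w). *)
    + exists ((Cmod (f z - f w) + 1) / (Cmod b - L)).
      pose proof (Cmod_ge_0 (f z - f w)) as Hd.
      split; [apply Rdiv_lt_0_compat; lra |]. intros s t Hs Ht.
      destruct (Hh (seg t) (Hseg t Ht)) as [C1 C2].
      destruct (Hh (seg s) (Hseg s Hs)) as [D1 D2].
      specialize (Hexp (h (seg s)) (h (seg t)) ltac:(lra) ltac:(lra)).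
      rewrite C2, D2 in Hexp.
      replace (seg s - seg t)%C with (- (RtoC (s - t) * (f z - f w)))%C in Hexp
        by (unfold seg; rewrite !RtoC_minus; ring).
      rewrite Cmod_opp, Cmod_mult, Cmod_R in Hexp.
      apply Rmult_le_reg_l with (Cmod b - L); [lra |].
      eapply Rle_trans; [exact Hexp |].
      replace ((Cmod b - L) * ((Cmod (f z - f w) + 1) / (Cmod b - L) * Rabs (s - t)))
        with ((Cmod (f z - f w) + 1) * Rabs (s - t)) by (field; lra).
      pose proof (Rabs_pos (s - t)). nra.
  - destruct (Hsurj (RtoC 0)) as [z Hz]. rewrite Cmod_0 in Hz. destruct (Hz HR0) as [H1 H2].
    exists z. split; [exact H1 | rewrite H2, Cmod_0; exact HR0].
  - intros z [Hz _]. exact Hz.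
  - intros z w [Hz _] [Hw _]. now apply Hinj.
  - intros w. split.
    + intros Hw. destruct (Hsurj w) as [z Hz]. destruct (Hz Hw) as [H1 H2].
      exists z. split; [| exact H2]. split; [exact H1 | rewrite H2; exact Hw].
    + intros (z & [_ Hz] & <-). exact Hz.
Qed.

(** * Univalence and the covered disk *)

(** At t = 0 the bound forces phi(0) = 0, and then the difference quotient is within K |t| of l. *)
Lemma Derive_0_of_quadratic_error (phi : R -> R) (l K : R) :
  (forall t, Rabs t <= / 2 -> Rabs (phi t - l * t) <= K * Rabs t ^ 2) -> Derive phi 0 = l.
Proof.
  intros H. apply is_derive_unique, is_derive_Reals. intros eps Heps.
  assert (H0 : phi 0 = 0).
  { specialize (H 0). rewrite Rabs_R0 in H. specialize (H ltac:(lra)).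
    replace (phi 0 - l * 0) with (phi 0) in H by ring. simpl in H.
    pose proof (Rabs_pos (phi 0)).
    destruct (Req_dec (phi 0) 0) as [E | E]; [exact E |]. apply Rabs_no_R0 in E. lra. }
  (* [K] may be zero or negative, hence the denominator |K| + 1. *)
  set (d := Rmin (/ 2) (eps / (Rabs K + 1))). pose proof (Rabs_pos K) as HK.
  assert (Hd : 0 < d) by (apply Rmin_pos; [lra | apply Rdiv_lt_0_compat; lra]).
  exists (mkposreal d Hd). simpl. intros h Hh Hhd.
  assert (Hh1 : Rabs h < / 2) by (eapply Rlt_le_trans; [exact Hhd | apply Rmin_l]).
  assert (Hh2 : Rabs h < eps / (Rabs K + 1)) by (eapply Rlt_le_trans; [exact Hhd | apply Rmin_r]).
  specialize (H h ltac:(lra)). pose proof (Rabs_pos_lt h Hh) as Hp.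
  rewrite Rplus_0_l, H0. replace ((phi h - 0) / h - l) with ((phi h - l * h) / h) by (field; exact Hh).
  unfold Rdiv. rewrite Rabs_mult, Rabs_inv.
  apply Rle_lt_trans with (K * Rabs h).
  - apply Rmult_le_reg_r with (Rabs h); [exact Hp |]. rewrite Rmult_assoc, Rinv_l by lra. nra.
  - apply (Rmult_lt_compat_l (Rabs K + 1)) in Hh2; [| lra].
    replace ((Rabs K + 1) * (eps / (Rabs K + 1))) with eps in Hh2 by (field; lra).
    pose proof (Rle_abs K). nra.
Qed.

(** To first order at 0, f is multiplication by b, whose real matrix has determinant |b|^2. *)
Lemma Jacobian_0_of_quadratic_error (f : C -> C) (b : C) (K : R) :
  (forall z, Cmod z <= / 2 -> Cmod (f z - b * z) <= K * Cmod z ^ 2) ->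
  Jacobian f (RtoC 0) = Cmod b ^ 2.
Proof.
  intros H.
  assert (Hx : forall t, Cmod (t, 0) = Rabs t) by (intros t; exact (Cmod_R t)).
  assert (Hy : forall t, Cmod (0, t) = Rabs t).
  { intros t. replace ((0, t) : C) with (Ci * t)%C by (unfold Ci, Cmult, RtoC; simpl; f_equal; ring).
    rewrite Cmod_mult, Cmod_Ci, Cmod_R. ring. }
  assert (Him : forall c : C, Rabs (Im c) <= Cmod c).
  { intros c. eapply Rle_trans; [| apply Rmax_Cmod]. apply Rmax_r. }
  destruct b as [b1 b2].
  assert (D1 : Derive (fun t => Re (f (t, 0))) 0 = b1).
  { apply Derive_0_of_quadratic_error with K. intros t Ht.
    specialize (H (t, 0)). rewrite Hx in H. eapply Rle_trans; [| now apply H].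
    eapply Rle_trans; [| apply re_le_Cmod]. right. f_equal. unfold Re, Im; simpl. ring. }
  assert (D2 : Derive (fun t => Im (f (t, 0))) 0 = b2).
  { apply Derive_0_of_quadratic_error with K. intros t Ht.
    specialize (H (t, 0)). rewrite Hx in H. eapply Rle_trans; [| now apply H].
    eapply Rle_trans; [| apply Him]. right. f_equal. unfold Re, Im; simpl. ring. }
  assert (D3 : Derive (fun t => Re (f (0, t))) 0 = - b2).
  { apply Derive_0_of_quadratic_error with K. intros t Ht.
    specialize (H (0, t)). rewrite Hy in H. eapply Rle_trans; [| now apply H].
    eapply Rle_trans; [| apply re_le_Cmod]. right. f_equal. unfold Re, Im; simpl. ring. }
  assert (D4 : Derive (fun t => Im (f (0, t))) 0 = b1).
  { apply Derive_0_of_quadratic_error with K. intros t Ht.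
    specialize (H (0, t)). rewrite Hy in H. eapply Rle_trans; [| now apply H].
    eapply Rle_trans; [| apply Him]. right. f_equal. unfold Re, Im; simpl. ring. }
  rewrite Cmod2_alt. unfold Jacobian, Dx, Dy. simpl. rewrite D1, D2, D3, D4. ring.
Qed.

Theorem theorem1p3
  (alpha beta M : R) (f fstar : C -> C) (c : Z -> C)
  (halpha : 0 <= alpha) (hbeta : 0 < beta)
  (hf : alpha_harmonic alpha f)
  (hbd : has_boundary_function alpha f fstar)
  (hcont : continuous_on_circle fstar)
  (hM : (forall z : C, disk 1 z -> Cmod (f z) <= M) /\
        (forall z : C, circle z -> Cmod (fstar z) <= M))
  (hf0 : f (RtoC 0) = RtoC 0)
  (hJ : Rabs (Jacobian f (RtoC 0)) = beta)
  (hexp : alpha_expansion alpha c f)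
  (hc1 : c (-1)%Z = RtoC 0)
  (hc2 : c (-2)%Z = RtoC 1)
  (hck : forall k : nat, (3 <= k)%nat ->
           Cmod (c (- Z.of_nat k)%Z) <= INR k - 1) :
  let equation (rho0 : R) :=
    beta * c_const alpha / (M * (alpha + 2))
    - (M + 5) * (rho0 * (2 - rho0) / (1 - rho0) ^ 2) = 0 in
  (exists rho0 : R, 0 < rho0 < 1 /\ equation rho0) /\
  forall rho0 : R, 0 < rho0 < 1 -> equation rho0 ->
    univalent_on (disk rho0) f /\
    exists R0 : R,
      (M + 5) * (rho0 / (1 - rho0)) ^ 2 <= R0 /\
      univalent_disk_in_image f rho0 R0.
Proof.
  intros equation.
  set (u := fun k => c (Z.of_nat k)). set (v := fun k => c (- Z.of_nat k)%Z).
  assert (Hser : harmonic_series alpha u v f).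
  { intros z Hz. destruct (proj2 hexp z Hz) as (S1 & S2 & HS1 & HS2 & HS).
    exists S1, S2. split; [exact HS1 | split; [| exact HS]].
    revert HS2. apply is_series_ext. intros j. symmetry. apply Cmult_assoc. }
  assert (Hv1 : v 1%nat = RtoC 0) by exact hc1.
  (* The three coefficient hypotheses merge into |c_(-k)| <= k - 1 for all k >= 1. *)
  assert (Hv : forall k, Cmod (v (S k)) <= INR k).
  { intros [| [| k]].
    - rewrite Hv1, Cmod_0. simpl. lra.
    - change (Cmod (c (-2)%Z) <= INR 1). rewrite hc2, Cmod_1. simpl. lra.
    - pose proof (hck (S (S (S k))) ltac:(lia)) as H. rewrite (S_INR (S (S k))) in H.
      unfold v. lra. }
  assert (Hu0 : u O = RtoC 0) by (rewrite <- hf0; now apply (harmonic_coef_0 alpha u v)).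
  assert (Hu : forall k, Cmod (u k) <= M)
    by (apply (harmonic_coef_le alpha u v f); [assumption .. | apply hM]).
  set (b := u 1%nat) in *.
  assert (HM0 : 0 <= M) by exact (Rle_trans _ _ _ (Cmod_ge_0 _) (Hu O)).
  (* Used with r = 1/2 for the Jacobian and with r = rho0 for the covered disk. *)
  assert (Hpert : forall r z, Cmod z <= r -> r < 1 -> Cmod (f z - b * z) <= (M + 1) / (1 - r) * Cmod z ^ 2).
  { intros r z Hz Hr.
    eapply Rle_trans; [apply (perturbation_le alpha u v f M); (assumption || lra) |].
    pose proof (pow2_ge_0 (Cmod z)).
    replace ((M + 1) / (1 - r) * Cmod z ^ 2) with ((M + 1) * Cmod z ^ 2 * / (1 - r)) by (field; lra).
    apply Rmult_le_compat_l; [nra |]. apply Rinv_le_contravar; lra. }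
  assert (Hbeta : beta = Cmod b ^ 2).
  { rewrite <- hJ, (Jacobian_0_of_quadratic_error f b _ (fun z Hz => Hpert (/ 2) z Hz ltac:(lra))).
    apply Rabs_pos_eq, pow2_ge_0. }
  assert (Hb : 0 < Cmod b) by (pose proof (Cmod_ge_0 b); nra).
  pose proof (Hu 1%nat) as HbM. fold b in HbM.
  destruct (c_const_bounds alpha halpha) as [Hc0 Hc1].
  set (X := beta * c_const alpha / (M * (alpha + 2))) in *.
  assert (HMa : 0 < M * (alpha + 2)) by nra.
  (* Here beta = |b|^2 with |b| <= M, while c_alpha <= 1 <= alpha + 2. *)
  assert (HX : 0 < X <= Cmod b).
  { unfold X. split; [apply Rdiv_lt_0_compat; nra |].
    apply Rmult_le_reg_r with (M * (alpha + 2)); [exact HMa |].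
    unfold Rdiv. rewrite Rmult_assoc, Rinv_l, Rmult_1_r, Hbeta by lra.
    apply Rle_trans with (Cmod b * (Cmod b * 1)); [nra |].
    apply Rmult_le_compat_l; nra. }
  split.
  (* Since r (2 - r) / (1 - r)^2 = 1 / (1 - r)^2 - 1, the equation says 1 / (1 - r)^2 = 1 + K and
     can be solved explicitly. *)
  - set (K := X / (M + 5)). assert (HK : 0 < K) by (apply Rdiv_lt_0_compat; lra).
    assert (Hs : 1 < sqrt (1 + K)) by (rewrite <- sqrt_1 at 1; apply sqrt_lt_1; lra).
    assert (Hss : sqrt (1 + K) * sqrt (1 + K) = 1 + K) by (apply sqrt_sqrt; lra).
    exists (1 - / sqrt (1 + K)). split.
    + assert (0 < / sqrt (1 + K) < 1); [| lra].
      split; [apply Rinv_0_lt_compat; lra |]. apply Rmult_lt_reg_r with (sqrt (1 + K)); [lra |]. rewrite Rinv_l; lra.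
    + unfold equation.
      replace ((1 - / sqrt (1 + K)) * (2 - (1 - / sqrt (1 + K))) / (1 - (1 - / sqrt (1 + K))) ^ 2)
        with (sqrt (1 + K) * sqrt (1 + K) - 1) by (field; lra).
      rewrite Hss. unfold K. field. lra.
  - intros r Hr Heq. unfold equation in Heq.
    set (D := / (1 - r) ^ 2). assert (HD : 0 < D) by (apply Rinv_0_lt_compat, pow_lt; lra).
    assert (HD1 : D * (1 - r) ^ 2 = 1) by (apply Rinv_l, pow_nonzero; lra).
    assert (HXr : X = (M + 5) * (r * (2 - r) * D)) by (unfold D, Rdiv in *; lra).
    set (L := M * (D - 1) + 3 * (r * D)).
    assert (HDr : D - 1 = r * (2 - r) * D) by nra.
    (* As 2 - r > 1, 3 r D < 5 r (2 - r) D; hence L < (M + 5) r (2 - r) D = X <= |b|. *)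
    assert (HL : 0 <= L < Cmod b).
    { assert (0 < r * D) by nra. assert (0 < r * (2 - r) * D) by (rewrite <- HDr; nra).
      unfold L. rewrite HDr. split; [nra |].
      assert (3 * (r * D) < 5 * (r * (2 - r) * D)) by nra. nra. }
    assert (Hlip : forall z w, Cmod z <= r -> Cmod w <= r ->
              Cmod ((f z - b * z) - (f w - b * w)) <= L * Cmod (z - w)).
    { intros z w Hz Hw. apply (perturbation_lip alpha u v f M r); (assumption || lra). }
    split; [exact (lipschitz_perturbation_univalent f b r L (proj2 HL) Hlip) |].
    exists ((M + 5) * (r / (1 - r)) ^ 2). split; [lra |].
    apply (disk_in_image_of_lipschitz_perturbation f b r L ((M + 1) / (1 - r) * r ^ 2));
      [lra | | exact HL | exact Hlip | |].
    + apply Rmult_lt_0_compat; [lra |]. apply pow_lt, Rdiv_lt_0_compat; lra.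
    + intros z Hz. eapply Rle_trans; [apply (Hpert r z Hz); lra |].
      apply Rmult_le_compat_l; [apply Rdiv_le_0_compat; lra |].
      apply pow_incr. split; [apply Cmod_ge_0 | exact Hz].
    (* Writing 2 - r = 1 + (1 - r) in X r = (M + 5) r^2 (2 - r) D, the first part is R0 and the
       second exceeds the bound on h by 4 r^2 (1 - r) D. *)
    + apply Rle_trans with (X * r); [| apply Rmult_le_compat_r; lra].
      replace ((M + 5) * (r / (1 - r)) ^ 2) with ((M + 5) * r ^ 2 * D) by (unfold D; field; lra).
      replace ((M + 1) / (1 - r) * r ^ 2) with ((M + 1) * r ^ 2 * ((1 - r) * D)) by (unfold D; field; lra).
      rewrite HXr.
      assert (0 <= r ^ 2 * D * (1 - r)) by (repeat apply Rmult_le_pos; lra). nra.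
Qed.
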